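(* Consider the single energy arrival problem with $E_{critical}<E<\bar E$, where $E_{critical}=\frac{T_\delta b}{a}\frac{De^{bD}}{e^{bD}-1}$ and $\bar E$ is the total energy of the optimal policy of the problem without energy constraint. (i) If there exist $t_0\in(0,D]$, $\beta>0$ and $C>0$ satisfying $$\frac{1}{\beta+Ce^{bt_0}}=\frac{T_\delta b}{a}+1,$$ $$e^{-bt_0}\left(\int_0^{t_0}e^{bt}\left(a\left(\frac{1}{\beta+Ce^{bt}}-1\right)+bT_e\right)dt+T_e\right)=T_c,$$ $$\int_0^{t_0}\left(\frac{1}{\beta+Ce^{bt}}-1\right)dt+\frac{T_\delta b}{a}(D-t_0)=E,$$ then the optimal policy is $P(t)=\frac{1}{\beta+Ce^{bt}}-1$ for $0\le t<t_0$ and $P(t)=\frac{T_\delta b}{a}$ for $t_0\le t\le D$. (ii) Otherwise, the temperature constraint is tight only at $t=D$, and the optimal policy is $P(t)=\frac{1}{\beta+Ce^{bt}}-1$ for $t\in[0,D]$, for some $\beta>0$ and $C>0$ satisfying $$e^{-bD}\left(\int_0^{D}e^{bt}\left(a\left(\frac{1}{\beta+Ce^{bt}}-1\right)+bT_e\right)dt+T_e\right)=T_c,\qquad \int_0^{D}\left(\frac{1}{\beta+Ce^{bt}}-1\right)dt=E.$$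
   Context: Single energy arrival problem: fix a deadline $D>0$, an available energy $E>0$, constants $a,b>0$, an environment temperature $T_e$ and a critical temperature $T_c>T_e$; set $T_\delta=T_c-T_e$. A power policy is a measurable function $P:[0,D]\to[0,\infty)$. The resulting temperature $T(t)$ solves $\frac{d}{dt}T(t)=aP(t)-b(T(t)-T_e)$, $T(0)=T_e$, i.e. $T(t)=T_e+e^{-bt}\int_0^t ae^{b\tau}P(\tau)\,d\tau$. The optimal policy is the maximizer of $\int_0^D\frac12\log_2(1+P(\tau))\,d\tau$ over power policies satisfying the temperature constraint $T(t)\le T_c$ for all $t\in[0,D]$ and the energy constraint $\int_0^DP(\tau)\,d\tau\le E$; it is unique almost everywhere, and statements identifying it are understood up to null sets. The problem without energy constraint is the same maximization with only the constraint $T(t)\le T_c$ for all $t\in[0,D]$; its maximizer has finite total energy $\bar E=\int_0^D P$. The temperature constraint is tight at $t$ if $T(t)=T_c$. *)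

(* Defs.v *)
From HB Require Import structures.
From mathcomp Require Import all_boot all_order all_algebra.
From mathcomp Require Import all_classical all_reals all_analysis.

Set Implicit Arguments.
Unset Strict Implicit.
Unset Printing Implicit Defensive.

Import Order.TTheory GRing.Theory Num.Theory.
Import numFieldNormedType.Exports.

Local Open Scope classical_set_scope.
Local Open Scope ring_scope.

Definition log2 (R : realType) (x : R) : R := ln x / ln 2.

(** A power policy [0, D] -> [0, +oo) is a total function R -> R of which only
    the values on [0, D] matter.  Measurability is Borel measurability. *)
Definition power_policy (R : realType) (D : R) (P : R -> R) : Prop :=
  measurable_fun `[0, D] P /\ (forall t, 0 <= t <= D -> 0 <= P t).

(** Explicit solution of T' = a P - b (T - Te), T(0) = Te.  The value is an
    extended real, so that a non-integrable policy has temperature +oo (a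
    real-valued integral would be 0 there) and violates every bound. *)
Definition temperature (R : realType) (a b Te : R) (P : R -> R) (t : R)
    : \bar R :=
  (Te%:E + (expR (- (b * t))%R)%:E *
     \int[lebesgue_measure]_(tau in `[0%R, t])
        (a * expR (b * tau) * P tau)%R%:E)%E.

Definition energy (R : realType) (D : R) (P : R -> R) : \bar R :=
  (\int[lebesgue_measure]_(tau in `[0%R, D]) (P tau)%:E)%E.

Definition throughput (R : realType) (D : R) (P : R -> R) : \bar R :=
  (\int[lebesgue_measure]_(tau in `[0%R, D]) (2^-1 * log2 (1 + P tau))%R%:E)%E.

Definition temp_feasible (R : realType) (a b Te Tc D : R) (P : R -> R)
    : Prop :=
  power_policy D P /\
  (forall t, 0 <= t <= D -> (temperature a b Te P t <= Tc%:E)%E).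

Definition feasible (R : realType) (a b Te Tc D E : R) (P : R -> R) : Prop :=
  temp_feasible a b Te Tc D P /\ (energy D P <= E%:E)%E.

Definition throughput_maximizer (R : realType) (D : R) (F : set (R -> R))
    (P : R -> R) : Prop :=
  F P /\ (forall Q, F Q -> (throughput D Q <= throughput D P)%E).

Definition optimal (R : realType) (a b Te Tc D E : R) (P : R -> R) : Prop :=
  throughput_maximizer D (feasible a b Te Tc D E) P.

Definition optimal_no_energy (R : realType) (a b Te Tc D : R) (P : R -> R)
    : Prop :=
  throughput_maximizer D (temp_feasible a b Te Tc D) P.

(** "The optimal policy is P": P is optimal, and it is the only optimal policy
    up to a null set. *)
Definition the_optimal_policy (R : realType) (a b Te Tc D E : R) (P : R -> R)
    : Prop :=
  optimal a b Te Tc D E P /\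
  (forall Q, optimal a b Te Tc D E Q ->
     {ae lebesgue_measure, forall t : R, 0 <= t <= D -> Q t = P t}).

Definition temp_tight (R : realType) (a b Te Tc : R) (P : R -> R) (t : R)
    : Prop :=
  temperature a b Te P t = Tc%:E.

Definition E_critical (R : realType) (a b Te Tc D : R) : R :=
  (Tc - Te) * b / a * (D * expR (b * D) / (expR (b * D) - 1)).

Definition exp_policy (R : realType) (b beta C : R) (t : R) : R :=
  1 / (beta + C * expR (b * t)) - 1.

Definition switching_policy (R : realType) (a b Te Tc t0 beta C : R) (t : R)
    : R :=
  if t < t0 then exp_policy b beta C t else (Tc - Te) * b / a.

(** The temperature reached at time s under [exp_policy b beta C].  The
    integrand is continuous on [0, s] when beta, C > 0, so the real-valued
    integral is the genuine one. *)
Definition exp_policy_temperature (R : realType) (a b Te beta C s : R) : R :=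
  expR (- (b * s)) *
  (\int[lebesgue_measure]_(t in `[0, s])
     (expR (b * t) * (a * exp_policy b beta C t + b * Te)) + Te).

Definition exp_policy_energy (R : realType) (b beta C s : R) : R :=
  \int[lebesgue_measure]_(t in `[0, s]) exp_policy b beta C t.

Definition switching_equations (R : realType) (a b Te Tc D E t0 beta C : R)
    : Prop :=
  [/\ 1 / (beta + C * expR (b * t0)) = (Tc - Te) * b / a + 1,
      exp_policy_temperature a b Te beta C t0 = Tc &
      exp_policy_energy b beta C t0 + (Tc - Te) * b / a * (D - t0) = E].

(* Main.v *)
Require Import Defs.
From HB Require Import structures.
From mathcomp Require Import all_boot all_order all_algebra.
From mathcomp Require Import all_classical all_reals all_analysis.
From mathcomp Require Import measurable_realfun ring lra.

Import Order.TTheory GRing.Theory Num.Theory.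
Import numFieldNormedType.Exports.

Local Open Scope classical_set_scope.
Local Open Scope ring_scope.

(** With [c = (Tc - Te) b / a] and [heat P u] the integral of [e^{b t} P t] over
    [[0, u]], the temperature constraint reads [heat P u <= (c / b) e^{b u}].
    All the candidates are of the form [1 / (beta + C e^{b min(s, t)}) - 1].
    Optimality and uniqueness come from the strict tangent inequality for
    [ln (1 + x)] at the candidate [P]: its slope [1 / (1 + P t)] is
    [beta + C e^{b min(s, t)}], and by Tonelli's theorem the integral of
    [e^{b min(s, t)} Q t] is a positive combination of the [heat Q u] for
    [s <= u <= D], where the temperature of [P] is tight.  The same argument with
    [beta = 0] identifies the optimum without energy constraint.

    For the existence in (ii), the level and temperature equations are solved
    explicitly along a curve of candidates going from the optimum without energy
    constraint to the constant policy of energy [E_critical].  The intermediate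
    value theorem gives a point of energy [E]; its switching time is [D], since
    otherwise the switching equations would be solvable. *)

(** * Tangent inequalities for the logarithm *)

(** This is the strict inequality [1 + u < e^u] at [u = - ln x]. *)
Lemma ln_gt1BV {R : realType} (x : R) : 0 < x -> x != 1 -> 1 - x^-1 < ln x.
Proof.
move=> x0 x1.
have : - ln x != 0 by rewrite oppr_eq0 ln_eq0.
by move=> /expR_gt1Dx; rewrite expRN lnK// ltrBlDl -ltrBlDr.
Qed.

Lemma ln_ge1BV {R : realType} (x : R) : 0 < x -> 1 - x^-1 <= ln x.
Proof.
move=> x0; have [->|x1] := eqVneq x 1; first by rewrite ln1 invr1 subrr.
exact/ltW/ln_gt1BV.
Qed.

(** Strict concavity, obtained from [ln_gt1BV] at the ratio [(1 + p) / (1 + q)]. Strictness is what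
    yields uniqueness of the optimum. *)
Lemma ln1D_tangent_lt {R : realType} (p q : R) : 0 <= p -> 0 <= q -> q != p ->
  ln (1 + q) < ln (1 + p) + (q - p) / (1 + p).
Proof.
move=> p0 q0 qp.
have p1 : 0 < 1 + p by lra.
have q1 : 0 < 1 + q by lra.
have := @ln_gt1BV R ((1 + p) / (1 + q)) (divr_gt0 p1 q1).
rewrite ln_div// invf_div => /(_ _)/wrap[].
  apply: contra qp => /eqP h; apply/eqP.
  have : 1 + p = 1 + q by rewrite -[LHS](divfK (lt0r_neq0 q1)) h mul1r.
  by lra.
have -> : (q - p) / (1 + p) = (1 + q) / (1 + p) - 1 by field; rewrite lt0r_neq0.
by lra.
Qed.

Lemma ln1D_tangent {R : realType} (p q : R) : 0 <= p -> 0 <= q ->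
  ln (1 + q) <= ln (1 + p) + (q - p) / (1 + p).
Proof.
move=> p0 q0; have [->|qp] := eqVneq q p; first by rewrite subrr mul0r addr0.
exact/ltW/ln1D_tangent_lt.
Qed.

(** * Explicit integrals and splitting of intervals *)

Lemma integral_antiderivative {R : realType} (f F : R -> R) (u v : R) : u <= v ->
  continuous f -> (forall x : R, is_derive x (1 : R) F (f x)) ->
  (\int[lebesgue_measure]_(x in `[u, v]) (f x)%:E = (F v - F u)%:E)%E.
Proof.
rewrite le_eqVlt => /predU1P[<-|uv] cf dF.
  by rewrite set_itv1 integral_set1 subrr.
have cF : continuous F.
  move=> x; apply/differentiable_continuous/derivable1_diffP.
  exact: (@ex_derive _ _ _ _ _ _ _ (dF x)).
rewrite (@continuous_FTC2 R f F u v uv) ?EFinB//.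
- exact: continuous_subspaceT.
- split => [x _||]; first exact: (@ex_derive _ _ _ _ _ _ _ (dF x)).
  + exact/cvg_at_right_filter/cF.
  + exact/cvg_at_left_filter/cF.
- by move=> x _; rewrite derive1E; exact: (@derive_val _ _ _ _ _ _ _ (dF x)).
Qed.

Lemma continuous_expRM {R : realType} (b : R) : continuous (fun t : R => expR (b * t)).
Proof.
by move=> x; apply: continuous_comp; [exact: mulrl_continuous|exact: continuous_expR].
Qed.

Lemma integral_expRM {R : realType} (b u v : R) : b != 0 -> u <= v ->
  (\int[lebesgue_measure]_(t in `[u, v]) (expR (b * t))%:E =
   ((expR (b * v) - expR (b * u)) / b)%:E)%E.
Proof.
move=> b0 uv.
have dF (x : R) : is_derive x (1 : R) (fun t : R => b^-1 * expR (b * t)) (expR (b * x)).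
  by apply: is_derive_eq; rewrite /GRing.scale/=; field.
rewrite (integral_antiderivative _ _ _ _ uv (continuous_expRM b) dF).
by congr EFin; ring.
Qed.

Lemma mixed_gt0 {R : realType} (beta C x : R) : 0 <= beta -> 0 < C ->
  0 < beta + C * expR x.
Proof. by move=> ? ?; rewrite ltr_wpDl// mulr_gt0// expR_gt0. Qed.

Lemma continuous_mixed {R : realType} (b beta C : R) :
  continuous (fun t : R => beta + C * expR (b * t)).
Proof.
move=> x; apply: cvgD; first exact: cvg_cst.
by apply: cvgM; [exact: cvg_cst|exact: continuous_expRM].
Qed.

(** The logarithmic derivative of [beta + C e^{b t}] provides the antiderivative. The parameters [p]
    and [q] cover both the heat of an exponential policy and the integrand of
    [exp_policy_temperature]. *)
Lemma integral_expRM_mixed {R : realType} (b beta C p q s : R) :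
  0 < b -> 0 <= beta -> 0 < C -> 0 <= s ->
  (\int[lebesgue_measure]_(t in `[0%R, s])
     (expR (b * t) * (p / (beta + C * expR (b * t)) + q))%:E =
   (p * ln ((beta + C * expR (b * s)) / (beta + C)) / (b * C) +
    q * (expR (b * s) - 1) / b)%:E)%E.
Proof.
move=> b0 be0 C0 s0.
have m0 x : 0 < beta + C * expR x by exact: mixed_gt0.
have dF (x : R) : is_derive x (1 : R)
    (fun t : R => p / (b * C) * ln (beta + C * expR (b * t)) + q / b * expR (b * t))
    (expR (b * x) * (p / (beta + C * expR (b * x)) + q)).
  have dln := is_derive1_ln (m0 (b * x)).
  have dm : is_derive x (1 : R) (fun t : R => beta + C * expR (b * t)) (C * (b * expR (b * x))).
    by apply: is_derive_eq; rewrite /GRing.scale/=; ring.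
  have dlnm := @is_derive1_comp _ (@ln R) (fun t : R => beta + C * expR (b * t)) x _ _ dln dm.
  apply: is_derive_eq; rewrite /GRing.scale/=.
  by field; rewrite !lt0r_neq0.
rewrite (integral_antiderivative _ _ _ _ s0 _ dF).
  rewrite mulr0 expR0 mulr1 ln_div// ?posrE//; last by rewrite ltr_wpDl.
  by congr EFin; ring.
move=> x; apply: cvgM; first exact: continuous_expRM.
apply: cvgD; last exact: cvg_cst.
apply: cvgM; first exact: cvg_cst.
by apply: cvgV; [rewrite lt0r_neq0|exact: continuous_mixed].
Qed.

Lemma ge0_integral_itv_split {R : realType} (f : R -> R) (u v w : R) :
  u <= v -> v <= w -> measurable_fun `[u, w] f ->
  (forall t, u <= t <= w -> 0 <= f t) ->
  (\int[lebesgue_measure]_(t in `[u, w]) (f t)%:E =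
   \int[lebesgue_measure]_(t in `[u, v]) (f t)%:E +
   \int[lebesgue_measure]_(t in `[v, w]) (f t)%:E)%E.
Proof.
move=> uv vw mf f0.
have -> : `[u, w]%classic = `[u, v]%classic `|` `]v, w]%classic.
  by rewrite -itv_bndbnd_setU// bnd_simp.
rewrite ge0_integral_setU//.
- congr (_ + _)%E; apply: integral_itv_obnd_cbnd; apply/measurable_EFinP.
  apply: measurable_funS mf => //.
  by move=> t /=; rewrite !in_itv/= => /andP[vt ->]; rewrite andbT (le_trans uv)// ltW.
- apply/measurable_EFinP; apply: measurable_funS mf => //.
  move=> t /= []; rewrite /= !in_itv/= => /andP[vt tw].
    by rewrite vt (le_trans tw).
  by rewrite tw andbT (le_trans uv)// ltW.
- move=> t [] /=; rewrite !in_itv/= => /andP[vt tw]; rewrite lee_fin f0//.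
    by rewrite vt (le_trans tw).
  by rewrite tw andbT (le_trans uv)// ltW.
- apply/disj_setPS => t [] /=; rewrite !in_itv/= => /andP[_ tv] /andP[vt _].
  by move: (le_lt_trans tv vt); rewrite ltxx.
Qed.

(** * Tonelli's theorem on a truncated triangle *)

Section triangle.
Context {R : realType}.
Local Notation mu := (@lebesgue_measure R).
Local Open Scope ereal_scope.

Variables (D s : R) (f g : R -> \bar R).
Hypothesis s0 : (0 <= s)%R.
Hypothesis mf : measurable_fun `[0%R, D] f.
Hypothesis mg : measurable_fun `[s, D] g.
Hypothesis f0 : forall t, `[0%R, D]%classic t -> 0 <= f t.
Hypothesis g0 : forall t, `[s, D]%classic t -> 0 <= g t.

(** Extension by zero to the whole plane, so that Tonelli's theorem applies to the product of two
    copies of Lebesgue measure. *)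
Definition triangle_kernel (x : R * R) : \bar R :=
  (f \_ `[0%R, D]) x.1 * (g \_ `[s, D]) x.2 * ((x.1 <= x.2)%R%:R : R)%:E.

Lemma patch_f_ge0 t : 0 <= (f \_ `[0%R, D]) t.
Proof. exact: erestrict_ge0. Qed.

Lemma patch_g_ge0 t : 0 <= (g \_ `[s, D]) t.
Proof. exact: erestrict_ge0. Qed.

Let kernel_ge0 x : 0 <= triangle_kernel x.
Proof. by rewrite /triangle_kernel !mule_ge0 ?patch_f_ge0 ?patch_g_ge0// lee_fin. Qed.

Let measurable_kernel : measurable_fun setT triangle_kernel.
Proof.
have mpf : measurable_fun setT (f \_ `[0%R, D]).
  exact/(measurable_restrictT _ _).1.
have mpg : measurable_fun setT (g \_ `[s, D]).
  exact/(measurable_restrictT _ _).1.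
apply: emeasurable_funM.
  apply: emeasurable_funM.
    by apply: (measurableT_comp mpf); exact: measurable_fst.
  by apply: (measurableT_comp mpg); exact: measurable_snd.
apply/measurable_EFinP.
rewrite (_ : (fun _ => _) = \1_[set x : R * R | (x.1 <= x.2)%R]); last first.
  by apply/funext => x; rewrite indicE/=; congr (nat_of_bool _)%:R; rewrite mem_setE.
apply: measurable_indic; rewrite -[X in measurable X]setTI.
exact: measurable_fun_le.
Qed.

Let inner_u t : \int[mu]_u triangle_kernel (t, u) =
  (f \_ `[0%R, D]) t * \int[mu]_(u in `[Num.max s t, D]) g u.
Proof.
have sub : `[Num.max s t, D] `<=` `[s, D].
  by move=> x; rewrite /= !in_itv/= ge_max -andbA => /and3P[-> _ ->].
rewrite [in RHS]integral_mkcond -ge0_integralZl//; last 3 first.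
- by apply/(measurable_restrictT _ _).1 => //; exact: measurable_funS mg.
- by move=> x _; apply: erestrict_ge0 => y /sub; exact: g0.
- exact: patch_f_ge0.
apply: eq_integral => u _; rewrite /triangle_kernel/= -muleA; congr (_ * _).
rewrite !patchE !mem_setE !in_itv/= ge_max.
by case: (s <= u)%R; case: (t <= u)%R; case: (u <= D)%R;
  rewrite /= ?mule1 ?mule0 ?mul0e.
Qed.

Let inner_t u : \int[mu]_t triangle_kernel (t, u) =
  ((fun u => g u * \int[mu]_(t in `[0%R, u]) f t) \_ `[s, D]) u.
Proof.
rewrite patchE; case: ifPn => uD; last first.
  rewrite integral0_eq// => t _.
  by rewrite /triangle_kernel/= [X in _ * X * _]patchE (negPf uD) mule0 mul0e.
move: (uD); rewrite mem_setE in_itv/= => /andP[su uD'].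
have sub : `[0%R, u] `<=` `[0%R, D].
  by move=> x; rewrite /= !in_itv/= => /andP[-> xu]/=; exact: le_trans uD'.
rewrite [in RHS]integral_mkcond -ge0_integralZl//; last 3 first.
- by apply/(measurable_restrictT _ _).1 => //; exact: measurable_funS mf.
- by move=> x _; apply: erestrict_ge0 => y /sub; exact: f0.
- by apply: g0; rewrite /= in_itv/= su.
apply: eq_integral => t _; rewrite /triangle_kernel/= [X in _ * X * _]patchE uD.
rewrite [X in X * _]muleC -muleA; congr (_ * _).
rewrite !patchE !mem_setE !in_itv/=.
case: (0 <= t)%R => /=; rewrite ?mul0e//.
have [tu|ut] := leP t u; first by rewrite (le_trans tu uD') mule1.
by rewrite mule0.
Qed.

(** Both sides are iterated integrals of [triangle_kernel]: for fixed [t] the variable [u] ranges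
    over [[max s t, D]], for fixed [u] the variable [t] ranges over [[0, u]]. *)
Lemma tonelli_triangle :
  \int[mu]_(t in `[0%R, D]) (f t * \int[mu]_(u in `[Num.max s t, D]) g u) =
  \int[mu]_(u in `[s, D]) (g u * \int[mu]_(t in `[0%R, u]) f t).
Proof.
transitivity (\int[mu]_u \int[mu]_t triangle_kernel (t, u)); last first.
  by rewrite [RHS]integral_mkcond; apply: eq_integral => u _; exact: inner_t.
transitivity (\int[mu]_t \int[mu]_u triangle_kernel (t, u)); last first.
  exact: (@fubini_tonelli _ _ _ _ R mu mu triangle_kernel).
rewrite integral_mkcond.
apply: eq_integral => t _; rewrite inner_u !patchE.
by case: ifPn; rewrite ?mul0e.
Qed.

Lemma measurable_triangle :
  measurable_fun `[s, D] (fun u => g u * \int[mu]_(t in `[0%R, u]) f t).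
Proof.
apply/measurable_restrictT => //.
rewrite [X in measurable_fun _ X](_ : _ =
    fun u => \int[mu]_t triangle_kernel (t, u)); last first.
  by apply/funext => u; rewrite inner_t.
exact: (@measurable_fun_fubini_tonelli_G _ _ _ _ R mu triangle_kernel).
Qed.

End triangle.

(** * Heat and the capped exponential weight *)

Definition heat {R : realType} (b : R) (P : R -> R) (u : R) : \bar R :=
  (\int[lebesgue_measure]_(t in `[0%R, u]) (expR (b * t) * P t)%:E)%E.

Definition capped_exp {R : realType} (b s t : R) : R := expR (b * Num.min s t).

(** Rests on [min s t + max s t = s + t]. The bracket is the integral over [[max s t, D]] of the
    density [b e^{b (s - u)}]; the last term is an atom at [D]. *)
Lemma capped_expE {R : realType} (b s D t : R) :
  capped_exp b s t = expR (b * t) * (expR (b * (s - Num.max s t)) - expR (b * (s - D)))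
    + expR (b * (s - D)) * expR (b * t).
Proof.
rewrite mulrBr addrAC [_ * expR (b * t)]mulrC -addrA subrr addr0 -expRD /capped_exp.
congr expR; rewrite -mulrDr; congr (_ * _).
by have := addr_max_min s t; lra.
Qed.

Section weighted.
Context {R : realType}.
Local Notation mu := (@lebesgue_measure R).
Variables (b s D : R).
Hypotheses (b0 : 0 < b) (s0 : 0 <= s) (sD : s <= D).

(** Density on [[s, D]] of the heat prices; the remaining mass [e^{b (s - D)}] sits at [D]. *)
Let g (u : R) := b * expR (b * (s - u)).

Let g_ge0 u : 0 <= g u.
Proof. by rewrite mulr_ge0 ?expR_ge0// ltW. Qed.

Let measurable_g (A : set R) : measurable_fun A g.
Proof.
apply: measurable_funTS; apply: continuous_measurable_fun => x.
apply: cvgM; first exact: cvg_cst.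
apply: continuous_comp; last exact: continuous_expR.
by apply: cvgM; [exact: cvg_cst|apply: cvgB; [exact: cvg_cst|exact: cvg_id]].
Qed.

Let integral_g v : v <= D ->
  (\int[mu]_(u in `[v, D]) (g u)%:E = (expR (b * (s - v)) - expR (b * (s - D)))%:E)%E.
Proof.
move=> vD; have dG (x : R) : is_derive x (1:R) (fun u : R => - expR (b * (s - u))) (g x).
  by apply: is_derive_eq; rewrite /g /GRing.scale/=; ring.
rewrite (integral_antiderivative _ _ _ _ vD _ dG); first by congr EFin; ring.
move=> x; apply: cvgM; first exact: cvg_cst.
apply: continuous_comp; last exact: continuous_expR.
by apply: cvgM; [exact: cvg_cst|apply: cvgB; [exact: cvg_cst|exact: cvg_id]].
Qed.

Lemma measurable_expRM_policy (Q : R -> R) :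
  measurable_fun `[0, D] Q -> measurable_fun `[0, D] (fun t => expR (b * t) * Q t).
Proof.
move=> mQ; apply: measurable_funM => //; apply: measurable_funTS.
by apply: continuous_measurable_fun; exact: continuous_expRM.
Qed.

(* Layer-cake formula: the cap [min s t] spreads the weight over the deadlines
   [u >= s] at which the temperature is constrained. *)
Lemma integral_capped_exp (Q : R -> R) : power_policy D Q ->
  (\int[mu]_(t in `[0%R, D]) (capped_exp b s t * Q t)%:E =
   \int[mu]_(u in `[s, D]) ((g u)%:E * heat b Q u) +
   (expR (b * (s - D)))%:E * heat b Q D)%E.
Proof.
move=> [mQ Q0].
have {}Q0 t : `[0, D]%classic t -> 0 <= expR (b * t) * Q t.
  by rewrite /= in_itv/= => tD; rewrite mulr_ge0 ?expR_ge0 ?Q0.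
have mQ' := measurable_expRM_policy _ mQ.
rewrite /heat -(@tonelli_triangle R D s (fun t => (expR (b * t) * Q t)%:E)
  (fun u => (g u)%:E))//; last 3 first.
- exact/measurable_EFinP.
- exact/measurable_EFinP.
- by move=> t _; rewrite lee_fin.
rewrite -ge0_integralZl ?lee_fin ?expR_ge0//; last exact/measurable_EFinP.
have E t : `[0, D]%classic t -> ((expR (b * t) * Q t)%:E *
    \int[mu]_(u in `[Num.max s t, D]) (g u)%:E =
  (expR (b * t) * Q t * (expR (b * (s - Num.max s t)) - expR (b * (s - D))))%:E)%E.
  by rewrite /= in_itv/= => /andP[_ tD]; rewrite integral_g// ge_max sD.
transitivity (\int[mu]_(t in `[0%R, D])
    ((expR (b * t) * Q t * (expR (b * (s - Num.max s t)) - expR (b * (s - D))))%:E +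
     (expR (b * (s - D)))%:E * (expR (b * t) * Q t)%:E))%E.
  apply: eq_integral => t _; rewrite -EFinM -EFinD; congr EFin.
  by rewrite (capped_expE b s D); ring.
rewrite ge0_integralD//.
- by congr (_ + _)%E; apply: eq_integral => t /set_mem tD; rewrite E.
- move=> t tD; rewrite lee_fin mulr_ge0// ?Q0// subr_ge0 ler_expR ler_pM2l//.
  by move: tD; rewrite /= in_itv/= lerD2l lerN2 ge_max sD => /andP[].
- apply/measurable_EFinP; apply: measurable_funM => //.
  apply: measurable_funTS; apply: continuous_measurable_fun => x.
  apply: cvgB; last exact: cvg_cst.
  apply: continuous_comp; last exact: continuous_expR.
  apply: cvgM; [exact: cvg_cst|apply: cvgB; first exact: cvg_cst].
  by apply: (@continuous_max _ _ (fun=> s) id x); [exact: cvg_cst|exact: cvg_id].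
- by move=> t /Q0; rewrite -EFinM lee_fin => h; rewrite mulr_ge0 ?expR_ge0.
- by apply/measurable_EFinP; apply: measurable_funM.
Qed.

(** In [integral_capped_exp] the heats at [u >= s] enter with nonnegative coefficients, so the
    comparison of heats carries over to the weighted integrals. *)
Lemma le_integral_capped_exp (P Q : R -> R) : power_policy D P -> power_policy D Q ->
  (forall u, s <= u <= D -> (heat b Q u <= heat b P u)%E) ->
  (\int[mu]_(t in `[0%R, D]) (capped_exp b s t * Q t)%:E <=
   \int[mu]_(t in `[0%R, D]) (capped_exp b s t * P t)%:E)%E.
Proof.
move=> pP pQ QP; rewrite !integral_capped_exp//.
have heat0 (V : R -> R) u : power_policy D V -> s <= u <= D -> (0 <= heat b V u)%E.
  move=> [_ V0] /andP[_ uD]; apply: integral_ge0 => t /=; rewrite in_itv/= => /andP[t0 tu].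
  by rewrite lee_fin mulr_ge0 ?expR_ge0 ?V0// t0 (le_trans tu).
have mheat V : power_policy D V ->
    measurable_fun `[s, D] (fun u => (g u)%:E * heat b V u)%E.
  move=> [mV V0].
  apply: (@measurable_triangle R D s (fun t => (expR (b * t) * V t)%:E) (fun u => (g u)%:E)) => //.
  - by apply/measurable_EFinP; exact: measurable_expRM_policy.
  - exact/measurable_EFinP.
  - by move=> t; rewrite /= in_itv/= => tD; rewrite lee_fin mulr_ge0 ?expR_ge0 ?V0.
  - by move=> t _; rewrite lee_fin.
apply: leeD.
  apply: ge0_le_integral => //.
  - by move=> u; rewrite /= in_itv/= => uD; rewrite mule_ge0 ?heat0// lee_fin.
  - exact: mheat.
  - exact: mheat.
  - by move=> u; rewrite /= in_itv/= => uD; rewrite lee_pmul2l ?QP// lte_fin mulr_gt0 ?expR_gt0.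
by rewrite lee_pmul2l ?QP ?sD ?lexx// lte_fin expR_gt0.
Qed.

End weighted.

(** * Throughput in natural logarithms and integrability of policies *)

Definition log_rate {R : realType} (D : R) (P : R -> R) : \bar R :=
  (\int[lebesgue_measure]_(t in `[0%R, D]) (ln (1 + P t))%:E)%E.

Section policy.
Context {R : realType}.
Local Notation mu := (@lebesgue_measure R).
Variables (D : R) (Q : R -> R).
Hypothesis polQ : power_policy D Q.

Let mQ : measurable_fun `[0, D] Q := polQ.1.
Let Q0 t : `[0, D]%classic t -> 0 <= Q t.
Proof. by rewrite /= in_itv/=; exact: polQ.2. Qed.

Lemma measurable_ln1D_policy : measurable_fun `[0, D] (fun t => ln (1 + Q t)).
Proof.
by apply: measurableT_comp; [exact: measurable_ln|exact: measurable_funD].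
Qed.

Lemma throughputE : throughput D Q = ((2^-1 / ln 2)%:E * log_rate D Q)%E.
Proof.
rewrite /throughput /log_rate -ge0_integralZl//.
- by apply: eq_integral => t _; rewrite /log2 -EFinM; congr EFin; ring.
- by apply/measurable_EFinP; exact: measurable_ln1D_policy.
- by move=> t /Q0 h; rewrite lee_fin ln_ge0// lerDl.
- by rewrite lee_fin divr_ge0// ln_ge0// ler1n.
Qed.

Lemma integrable_le_policy (f : R -> R) : mu.-integrable `[0, D] (EFin \o Q) ->
  measurable_fun `[0, D] f -> (forall t, 0 <= t <= D -> 0 <= f t <= Q t) ->
  mu.-integrable `[0, D] (EFin \o f).
Proof.
move=> iQ mf fQ; apply: le_integrable iQ => //; first exact/measurable_EFinP.
move=> t tD; have := fQ t; move: (tD); rewrite /= in_itv/= => h /(_ h) /andP[f0 fq].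
by rewrite lee_fin !ger0_norm ?Q0.
Qed.

Lemma integrable_ln1D_policy : mu.-integrable `[0, D] (EFin \o Q) ->
  mu.-integrable `[0, D] (EFin \o (fun t => ln (1 + Q t))).
Proof.
move=> iQ; apply: integrable_le_policy => //; first exact: measurable_ln1D_policy.
move=> t tD; have Qt : 0 <= Q t by exact: polQ.2.
by rewrite ln_ge0 ?lerDl//= le_ln1Dx//; lra.
Qed.

(** The weight [e^{b t}] is at least 1 on [[0, D]], so the heat dominates the energy. *)
Lemma integrable_heat (b : R) : 0 < b -> (heat b Q D < +oo)%E ->
  mu.-integrable `[0, D] (EFin \o Q).
Proof.
move=> b0 hQ; apply/integrableP; split; first exact/measurable_EFinP.
apply: le_lt_trans hQ; apply: ge0_le_integral => //.
- by apply: measurableT_comp => //; exact/measurable_EFinP.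
- by apply/measurable_EFinP; exact: measurable_expRM_policy.
- move=> t tD; rewrite lee_fin ger0_norm ?Q0// ler_peMl ?Q0//.
  rewrite -expR0 ler_expR mulr_ge0 ?(ltW b0)//.
  by move: tD; rewrite /= in_itv/= => /andP[].
Qed.

End policy.

(** * Sufficient conditions for optimality *)

Section verification.
Context {R : realType}.
Local Notation mu := (@lebesgue_measure R).
Variables (b beta C s D : R) (P Q : R -> R).
Hypotheses (b0 : 0 < b) (beta0 : 0 <= beta) (C0 : 0 < C).
Hypotheses (s0 : 0 <= s) (sD : s <= D).
Hypotheses (polP : power_policy D P) (polQ : power_policy D Q).

Let g t := beta + C * capped_exp b s t.

(* Stationarity: the marginal rate [1 / (1 + P)] is [beta] (the price of energy)
   plus the price of heat at the instants [u >= s] where the temperature is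
   tight. *)
Hypothesis PE : forall t, 0 <= t <= D -> (1 + P t)^-1 = g t.
Hypothesis heatP : (heat b P D < +oo)%E.
Hypothesis heatQ : forall u, s <= u <= D -> (heat b Q u <= heat b P u)%E.
(** Complementary slackness: scaled by the price [beta], the comparison also covers the problem
    without energy constraint, where [beta = 0] and both sides vanish. *)
Hypothesis energyQ : (beta%:E * energy D Q <= beta%:E * energy D P)%E.

Let g_gt0 t : 0 < g t.
Proof. by rewrite /g mixed_gt0. Qed.

Let g_le1 t : 0 <= t <= D -> g t <= 1.
Proof.
by move=> tD; have Pt := polP.2 _ tD; rewrite -PE// invf_le1; lra.
Qed.

Let measurable_capped (A : set R) : measurable_fun A (capped_exp b s).
Proof.
apply: measurable_funTS; apply: continuous_measurable_fun => x.
apply: continuous_comp; last exact: continuous_expR.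
apply: cvgM; first exact: cvg_cst.
by apply: (@continuous_min _ _ (fun=> s) id x); [exact: cvg_cst|exact: cvg_id].
Qed.

Let measurable_g (A : set R) : measurable_fun A g.
Proof. by apply: measurable_funD => //; exact: measurable_funM. Qed.

Let integral_g (V : R -> R) : power_policy D V ->
  (\int[mu]_(t in `[0%R, D]) (g t * V t)%:E = beta%:E * energy D V +
   C%:E * \int[mu]_(t in `[0%R, D]) (capped_exp b s t * V t)%:E)%E.
Proof.
move=> [mV V0]; rewrite /energy.
have V0' t : `[0, D]%classic t -> 0 <= V t by rewrite /= in_itv/=; exact: V0.
have w0 t : 0 <= capped_exp b s t by exact: expR_ge0.
have mwV : measurable_fun `[0, D] (fun t => capped_exp b s t * V t).
  exact: measurable_funM.
rewrite -ge0_integralZl ?lee_fin//; last exact/measurable_EFinP.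
rewrite -ge0_integralZl ?lee_fin ?(ltW C0)//; last 2 first.
- exact/measurable_EFinP.
- by move=> t tD; rewrite lee_fin mulr_ge0 ?V0'.
rewrite -ge0_integralD//.
- by apply: eq_integral => t _; rewrite -!EFinM -EFinD /g; congr EFin; ring.
- by move=> t tD; rewrite -EFinM lee_fin mulr_ge0 ?V0'.
- by apply/measurable_EFinP; apply: measurable_funM.
- by move=> t tD; rewrite -EFinM lee_fin mulr_ge0 ?mulr_ge0 ?V0'// ltW.
- by apply/measurable_EFinP; apply: measurable_funM.
Qed.

Let iP : mu.-integrable `[0, D] (EFin \o P).
Proof. exact: (@integrable_heat _ _ _ polP b). Qed.

Let iQ : mu.-integrable `[0, D] (EFin \o Q).
Proof.
apply: (@integrable_heat _ _ _ polQ b) => //.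
by rewrite (le_lt_trans _ heatP)// heatQ// sD lexx.
Qed.

Let igV (V : R -> R) : power_policy D V -> mu.-integrable `[0, D] (EFin \o V) ->
  mu.-integrable `[0, D] (EFin \o (fun t => g t * V t)).
Proof.
move=> polV iV; apply: (integrable_le_policy D V polV _ iV).
  by apply: measurable_funM => //; exact: polV.1.
move=> t tD; have V0 := polV.2 t tD.
by rewrite mulr_ge0 ?(ltW (g_gt0 _))//= ler_piMl// g_le1.
Qed.

(** Slack at [t] in the tangent inequality at [P t], whose slope is [g t] by stationarity. *)
Let gap t := ln (1 + P t) - ln (1 + Q t) + (g t * Q t - g t * P t).

Let gap_ge0 t : 0 <= t <= D -> 0 <= gap t.
Proof.
move=> tD; have := @ln1D_tangent R _ _ (polP.2 _ tD) (polQ.2 _ tD).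
by rewrite PE// /gap => h; lra.
Qed.

Let gap_eq0 t : 0 <= t <= D -> gap t = 0 -> Q t = P t.
Proof.
move=> tD; have [//|QP] := eqVneq (Q t) (P t).
have := @ln1D_tangent_lt R _ _ (polP.2 _ tD) (polQ.2 _ tD) QP.
by rewrite PE// /gap => h1 h2; exfalso; lra.
Qed.

Let integrable_gap : mu.-integrable `[0, D] (EFin \o gap).
Proof.
have iL V : power_policy D V -> mu.-integrable `[0, D] (EFin \o V) ->
    mu.-integrable `[0, D] (EFin \o (fun t => ln (1 + V t))).
  by move=> polV iV; exact: integrable_ln1D_policy.
have -> : EFin \o gap = (((EFin \o (fun t => ln (1 + P t))%R) \-
    (EFin \o (fun t => ln (1 + Q t))%R)) \+ ((EFin \o (fun t => g t * Q t)%R) \-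
    (EFin \o (fun t => g t * P t)%R)))%E by [].
by apply: integrableD => //; apply: integrableB => //; [exact: iL..|exact: igV|exact: igV].
Qed.

(** The integral of [g Q] does not exceed that of [g P]: the [beta] part by [energyQ], the capped
    part by the comparison of heats. All terms are integrable, so the integral of [gap] may be
    split. *)
Let integral_gap_le :
  (\int[mu]_(t in `[0%R, D]) (gap t)%:E <= log_rate D P - log_rate D Q)%E.
Proof.
have iL V : power_policy D V -> mu.-integrable `[0, D] (EFin \o V) ->
    mu.-integrable `[0, D] (EFin \o (fun t => ln (1 + V t))).
  by move=> polV iV; exact: integrable_ln1D_policy.
rewrite [leLHS](_ : _ = \int[mu]_(t in `[0%R, D])
  (((ln (1 + P t))%R%:E - (ln (1 + Q t))%R%:E) +
   ((g t * Q t)%R%:E - (g t * P t)%R%:E)))%E//.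
rewrite integralD//; last 2 first.
- by apply: integrableB => //; exact: iL.
- by apply: integrableB => //; exact: igV.
rewrite !integralB_EFin//; try by [exact: iL|exact: igV].
rewrite -[leRHS]adde0 leeD2l// sube_le0.
  by rewrite !integral_g// leeD// lee_pmul2l ?lte_fin// le_integral_capped_exp.
Qed.

Let log_rate_fin (V : R -> R) : power_policy D V -> mu.-integrable `[0, D] (EFin \o V) ->
  log_rate D V \is a fin_num.
Proof.
by move=> polV iV; apply: integrable_fin_num => //; exact: integrable_ln1D_policy.
Qed.

Let rate_gt0 : 0 < 2^-1 / ln 2 :> R.
Proof. by rewrite divr_gt0// ln_gt0// ltr1n. Qed.

Lemma verification_le : (throughput D Q <= throughput D P)%E.
Proof.
rewrite !throughputE// lee_pmul2l//.
rewrite -sube_ge0 ?log_rate_fin//.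
apply: le_trans integral_gap_le; apply: integral_ge0 => t.
by rewrite /= in_itv/= => tD; rewrite lee_fin gap_ge0.
Qed.

(** Equal throughputs force the nonnegative [gap] to have integral 0, hence to vanish almost
    everywhere, and the strict tangent inequality then gives [Q t = P t]. *)
Lemma verification_eq : (throughput D P <= throughput D Q)%E ->
  {ae mu, forall t : R, 0 <= t <= D -> Q t = P t}.
Proof.
rewrite !throughputE// lee_pmul2l// => PQ.
have : (\int[mu]_(t in `[0%R, D]) `|(gap t)%:E| = 0)%E.
  apply/eqP; rewrite eq_le integral_ge0// andbT.
  rewrite [leLHS](_ : _ = \int[mu]_(t in `[0%R, D]) (gap t)%:E)%E; last first.
    apply: eq_integral => t /set_mem; rewrite /= in_itv/= => tD.
    by rewrite ger0_norm// gap_ge0.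
  by rewrite (le_trans integral_gap_le)// sube_le0// log_rate_fin.
have mgap : measurable_fun `[0%R, D] (EFin \o gap) by case/integrableP : integrable_gap.
move=> /(ae_eq_integral_abs mu _ mgap) -/(_ _)/wrap[]//.
apply: filterS => t h tD; apply: gap_eq0 => //.
by have := h; rewrite /= in_itv/= => /(_ tD)[].
Qed.

End verification.

(** * The temperature constraint as a bound on heat *)

Section temperature.
Context {R : realType}.
Variables (a b Te Tc D : R).
Hypotheses (a0 : 0 < a) (b0 : 0 < b).

Lemma temperatureE (P : R -> R) (t : R) : power_policy D P -> 0 <= t <= D ->
  temperature a b Te P t = (Te%:E + (a * expR (- (b * t)))%:E * heat b P t)%E.
Proof.
move=> [mP P0] /andP[t0 tD]; rewrite /temperature /heat.
have sub : `[0, t] `<=` `[0, D].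
  by move=> x; rewrite /= !in_itv/= => /andP[-> xt]/=; exact: le_trans tD.
have P0' x : `[0, t]%classic x -> 0 <= P x.
  by move=> /sub; rewrite /= in_itv/=; exact: P0.
rewrite [in RHS]mulrC EFinM -muleA; congr (_ + _ * _)%E.
rewrite -ge0_integralZl ?lee_fin ?(ltW a0)//.
- by apply: eq_integral => x _; rewrite -EFinM mulrA.
- apply/measurable_EFinP; apply: measurable_funS (measurable_expRM_policy _ _ P mP) => //.
- by move=> x /P0' Px; rewrite lee_fin mulr_ge0 ?expR_ge0.
Qed.

Let temp_limit (t x : R) : (Te + a * expR (- (b * t)) * x <= Tc) =
  (x <= (Tc - Te) / a * expR (b * t)).
Proof.
by rewrite -lerBrDl expRN -ler_pdivlMl ?divr_gt0 ?expR_gt0// invf_div mulrC mulrAC mulrA.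
Qed.

Let temp_limit_eq (t x : R) : (Te + a * expR (- (b * t)) * x == Tc) =
  (x == (Tc - Te) / a * expR (b * t)).
Proof.
by rewrite expRN; apply/eqP/eqP => [<-|->]; field; rewrite !lt0r_neq0 ?expR_gt0.
Qed.

Lemma temperature_le (P : R -> R) (t : R) : power_policy D P -> 0 <= t <= D ->
  (temperature a b Te P t <= Tc%:E)%E =
  (heat b P t <= ((Tc - Te) / a * expR (b * t))%:E)%E.
Proof.
move=> pP tD; rewrite temperatureE//.
have k0 : 0 < a * expR (- (b * t)) by rewrite mulr_gt0 ?expR_gt0.
case: (heat b P t) => [x||].
- by rewrite -EFinM -EFinD !lee_fin temp_limit.
- by rewrite gt0_muley ?lte_fin//= !leye_eq.
- by rewrite gt0_muleNy ?lte_fin//= !leNye.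
Qed.

Lemma temp_tightE (P : R -> R) (t : R) : power_policy D P -> 0 <= t <= D ->
  temp_tight a b Te Tc P t <-> heat b P t = ((Tc - Te) / a * expR (b * t))%:E.
Proof.
move=> pP tD; rewrite /temp_tight temperatureE//.
have k0 : 0 < a * expR (- (b * t)) by rewrite mulr_gt0 ?expR_gt0.
case: (heat b P t) => [x||].
- rewrite -EFinM -EFinD; split => -[] /eqP.
    by rewrite temp_limit_eq => /eqP ->.
  by rewrite -temp_limit_eq => /eqP ->.
- by rewrite gt0_muley ?lte_fin//=; split.
- by rewrite gt0_muleNy ?lte_fin//=; split.
Qed.

End temperature.

(** * Heat, temperature and energy of exponential policies *)

Section exp_policy.
Context {R : realType}.
Variables (b beta C : R).
Hypotheses (b0 : 0 < b) (beta0 : 0 <= beta) (C0 : 0 < C).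

Lemma heat_exp_policy (s : R) : 0 <= s ->
  heat b (exp_policy b beta C) s =
  ((ln ((beta + C * expR (b * s)) / (beta + C)) / C - (expR (b * s) - 1)) / b)%:E.
Proof.
move=> s0; rewrite /heat /exp_policy (integral_expRM_mixed b beta C 1 (-1))//.
by congr EFin; field; rewrite !lt0r_neq0//; rewrite ltr_wpDl.
Qed.

(** The term [b Te] integrates to [Te (e^{b s} - 1)], which the added [Te] completes to
    [Te e^{b s}]. *)
Lemma exp_policy_temperatureE (a Te s : R) : 0 <= s ->
  exp_policy_temperature a b Te beta C s = Te + a * expR (- (b * s)) *
    ((ln ((beta + C * expR (b * s)) / (beta + C)) / C - (expR (b * s) - 1)) / b).
Proof.
move=> s0; rewrite /exp_policy_temperature /Rintegral.
have -> : (\int[lebesgue_measure]_(t in `[0%R, s])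
    (expR (b * t) * (a * exp_policy b beta C t + b * Te))%:E =
  \int[lebesgue_measure]_(t in `[0%R, s])
    (expR (b * t) * (a / (beta + C * expR (b * t)) + (b * Te - a)))%:E)%E.
  by apply: eq_integral => t _; congr EFin; rewrite /exp_policy; ring.
rewrite integral_expRM_mixed//= expRN.
by field; rewrite !lt0r_neq0 ?expR_gt0//; rewrite ltr_wpDl.
Qed.

End exp_policy.

Section exp_policy_monotone.
Context {R : realType}.
Variables (b beta C : R).
Hypotheses (b0 : 0 < b) (beta0 : 0 <= beta) (C0 : 0 < C).

Lemma continuous_exp_policy : continuous (exp_policy b beta C).
Proof.
move=> x; apply: cvgB; last exact: cvg_cst.
apply: cvgM; first exact: cvg_cst.
by apply: cvgV; [rewrite lt0r_neq0// mixed_gt0|exact: continuous_mixed].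
Qed.

Lemma integral_exp_policy (s : R) :
  (\int[lebesgue_measure]_(t in `[0%R, s]) (exp_policy b beta C t)%:E =
   (exp_policy_energy b beta C s)%:E)%E.
Proof.
rewrite /exp_policy_energy /Rintegral fineK//; apply: integrable_fin_num => //.
apply: continuous_compact_integrable; first exact: segment_compact.
exact/continuous_subspaceT/continuous_exp_policy.
Qed.

Lemma exp_policy_nincr (t u : R) : t <= u -> exp_policy b beta C u <= exp_policy b beta C t.
Proof.
move=> tu; rewrite /exp_policy lerD2r !mul1r lef_pV2 ?posrE ?mixed_gt0//.
by rewrite lerD2l ler_pM2l// ler_expR ler_pM2l.
Qed.

End exp_policy_monotone.

(** * Feasibility, tightness and optimality of capped policies *)

Section capped_policy.
Context {R : realType}.
Local Notation mu := (@lebesgue_measure R).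
Variables (a b Te Tc D s beta C : R) (P : R -> R).
Hypotheses (a0 : 0 < a) (b0 : 0 < b) (TeTc : Te < Tc).
Hypotheses (s0 : 0 <= s) (sD : s <= D) (beta0 : 0 <= beta) (C0 : 0 < C).

(** The steady power: it balances cooling at the temperature [Tc]. *)
Let c := (Tc - Te) * b / a.
Let y t := beta + C * expR (b * t).

(* [switching_policy] for [s = t0] (given [y_eq]), and [exp_policy] for [s = D]. *)
Hypothesis PE : forall t, 0 <= t <= D -> P t = exp_policy b beta C (Num.min s t).
(** Level condition: the power reached at [s] is at least [c], with equality when a constant tail
    follows. *)
Hypothesis y_le : (c + 1) * y s <= 1.
Hypothesis y_eq : s < D -> (c + 1) * y s = 1.
Hypothesis tight : exp_policy_temperature a b Te beta C s = Tc.

Let c0 : 0 < c.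
Proof. by rewrite !mulr_gt0 ?invr_gt0// subr_gt0. Qed.

Let y0 t : 0 < y t.
Proof. exact: mixed_gt0. Qed.

Let polP : power_policy D P.
Proof.
split.
  apply: (@eq_measurable_fun _ _ _ _ _ (exp_policy b beta C \o Num.min s)).
    by move=> t /set_mem; rewrite /= in_itv/= => tD; rewrite PE.
  apply: measurable_funTS; apply: continuous_measurable_fun => x.
  apply: continuous_comp; last exact: continuous_exp_policy.
  by apply: (@continuous_min _ _ (fun=> s) id x); [exact: cvg_cst|exact: cvg_id].
move=> t tD; rewrite PE//.
(* The policy is smallest at the cap [s], where the level condition makes it nonnegative. *)
apply: (@le_trans _ _ (exp_policy b beta C s)); last first.
  by rewrite exp_policy_nincr// ge_min lexx.
rewrite /exp_policy mul1r subr_ge0 -/(y s) -(ler_pM2r (y0 s)) mul1r.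
rewrite mulVf ?lt0r_neq0//.
by apply: le_trans y_le; rewrite ler_peMl ?ltW// ltrDr.
Qed.

Let heatP (t : R) : 0 <= t -> t <= s -> heat b P t =
  ((ln (y t / (beta + C)) / C - (expR (b * t) - 1)) / b)%:E.
Proof.
move=> t0 ts; rewrite -heat_exp_policy//; apply: eq_integral => x /set_mem.
rewrite /= in_itv/= => /andP[x0 xt].
have xs : x <= s by exact: le_trans ts.
by rewrite PE ?x0 ?(le_trans xs)// (min_idPr xs).
Qed.

Let tightE : ln (y s / (beta + C)) = C * ((c + 1) * expR (b * s) - 1).
Proof.
have := tight; rewrite exp_policy_temperatureE// -/(y s) expRN => /eqP.
rewrite addrC eq_sym -subr_eq => /eqP E.
have e0 := expR_gt0 (b * s).
have h : c * expR (b * s) = ln (y s / (beta + C)) / C - (expR (b * s) - 1).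
  by rewrite /c E; field; rewrite !lt0r_neq0.
have -> : (c + 1) * expR (b * s) - 1 = ln (y s / (beta + C)) / C.
  by rewrite mulrDl mul1r h; ring.
by rewrite [RHS]mulrC divfK// lt0r_neq0.
Qed.

Let limitE t : (Tc - Te) / a * expR (b * t) = c * expR (b * t) / b.
Proof. by rewrite /c; field; rewrite !lt0r_neq0. Qed.

(** After [tightE] is substituted, the claim reads [ln (y s / y t) > (c + 1) (y s - y t)]. The left
    side exceeds [1 - y t / y s = (y s - y t) / y s], and [1 / y s >= c + 1] by the level
    condition. *)
Let heat_lt t : 0 <= t -> t < s ->
  (heat b P t < ((Tc - Te) / a * expR (b * t))%:E)%E.
Proof.
move=> t0 ts; rewrite heatP// ?(ltW ts)// lte_fin limitE ltr_pM2r ?invr_gt0//.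
have bC : 0 < beta + C by rewrite ltr_wpDl.
have yts : y t < y s by rewrite ltrD2l ltr_pM2l// ltr_expR ltr_pM2l.
have := @ln_gt1BV R (y s / y t) (divr_gt0 (y0 s) (y0 t)).
rewrite invf_div => /(_ _)/wrap[].
  apply/negP => /eqP h; have : y s = y t by rewrite -(divfK (lt0r_neq0 (y0 t)) (y s)) h mul1r.
  by move=> h'; move: yts; rewrite h' ltxx.
have -> : y s / y t = (y s / (beta + C)) / (y t / (beta + C)).
  by field; rewrite !lt0r_neq0.
rewrite ln_div ?posrE ?divr_gt0// tightE => h.
have h2 : (c + 1) * (y s - y t) <= 1 - y t / y s.
  have -> : 1 - y t / y s = (y s)^-1 * (y s - y t) by field; rewrite lt0r_neq0.
  rewrite ler_pM2r ?subr_gt0// -(ler_pM2r (y0 s)) mulVf// lt0r_neq0//.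
have h3 : y s - y t = C * (expR (b * s) - expR (b * t)) by rewrite /y; ring.
rewrite ltrBlDr ltr_pdivrMr//; rewrite h3 in h2.
suff -> : (c * expR (b * t) + (expR (b * t) - 1)) * C =
   C * ((c + 1) * expR (b * s) - 1) - (c + 1) * (C * (expR (b * s) - expR (b * t))) by lra.
by ring.
Qed.

Let heat_s : heat b P s = ((Tc - Te) / a * expR (b * s))%:E.
Proof.
rewrite heatP// tightE limitE; congr EFin.
by field; rewrite !lt0r_neq0.
Qed.

Let P_tail t : s <= t <= D -> s < D -> P t = c.
Proof.
move=> /andP[st tD] /y_eq y1; rewrite PE ?tD ?andbT ?(le_trans s0)//.
rewrite (min_idPl st) /exp_policy -/(y s) mul1r.
rewrite -[X in X - 1](mulfK (lt0r_neq0 (y0 s))) mulVf ?lt0r_neq0// -[X in X / _]y1.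
by rewrite mulfK ?lt0r_neq0//; ring.
Qed.

(** After [s] the constant power [c] adds the heat [(c / b) (e^{b u} - e^{b s})], exactly the growth
    of the limit. *)
Let heat_eq u : s <= u <= D -> heat b P u = ((Tc - Te) / a * expR (b * u))%:E.
Proof.
move=> /andP[]; rewrite le_eqVlt => /predU1P[<- _|su uD]; first exact: heat_s.
have sD' : s < D by exact: lt_le_trans uD.
rewrite /heat (ge0_integral_itv_split _ 0 s u)//; last 3 first.
- exact: ltW.
- apply: measurable_funS (measurable_expRM_policy b D P polP.1) => //.
  by move=> x; rewrite /= !in_itv/= => /andP[-> xu]/=; exact: le_trans uD.
- move=> t /andP[t0 tu]; rewrite mulr_ge0 ?expR_ge0// polP.2// t0.
  exact: le_trans uD.
rewrite -/(heat b P s) heat_s.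
have -> : (\int[mu]_(t in `[s, u]) (expR (b * t) * P t)%:E =
    c%:E * \int[mu]_(t in `[s, u]) (expR (b * t))%:E)%E.
  rewrite -ge0_integralZl ?lee_fin ?(ltW c0)//.
  - apply: eq_integral => t /set_mem; rewrite /= in_itv/= => /andP[st tu].
    by rewrite P_tail ?st ?(le_trans tu)// mulrC EFinM.
  - apply/measurable_EFinP; apply: measurable_funTS.
    by apply: continuous_measurable_fun; exact: continuous_expRM.
rewrite integral_expRM ?lt0r_neq0 ?(ltW su)// -EFinM -EFinD !limitE.
by congr EFin; field; rewrite lt0r_neq0.
Qed.

Let heat_le t : 0 <= t <= D -> (heat b P t <= ((Tc - Te) / a * expR (b * t))%:E)%E.
Proof.
move=> /andP[t0 tD]; have [st|ts] := leP s t; first by rewrite heat_eq// st.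
exact/ltW/heat_lt.
Qed.

Lemma capped_temp_feasible : temp_feasible a b Te Tc D P.
Proof. by split=> // t tD; rewrite (temperature_le _ _ _ _ D)// heat_le. Qed.

Lemma capped_temp_tight t : 0 <= t <= D -> temp_tight a b Te Tc P t <-> s <= t.
Proof.
move=> tD; rewrite (temp_tightE _ _ _ _ D)//; split=> [h|st].
  rewrite leNgt; apply/negP => ts.
  by have := heat_lt _ (proj1 (andP tD)) ts; rewrite h ltxx.
by rewrite heat_eq// st; case/andP : tD.
Qed.

Lemma capped_energy :
  energy D P = (exp_policy_energy b beta C s + c * (D - s))%:E.
Proof.
rewrite /energy (ge0_integral_itv_split _ 0 s D)//; last 2 first.
- exact: polP.1.
- exact: polP.2.
rewrite EFinD -integral_exp_policy//; congr (_ + _)%E.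
  apply: eq_integral => x /set_mem; rewrite /= in_itv/= => /andP[x0 xs].
  by rewrite PE ?x0 ?(le_trans xs)// (min_idPr xs).
move: sD; rewrite le_eqVlt => /predU1P[->|sD'].
  by rewrite set_itv1 integral_set1 subrr mulr0.
transitivity (\int[mu]_(t in `[s, D]) c%:E)%E.
  by apply: eq_integral => t /set_mem; rewrite /= in_itv/= => tD; rewrite P_tail.
by rewrite integral_cst//= lebesgue_measure_itv/= lte_fin sD' -EFinB -EFinM.
Qed.

Section competitor.
Variable Q : R -> R.
Hypothesis feasQ : temp_feasible a b Te Tc D Q.
Hypothesis energyQ : (beta%:E * energy D Q <= beta%:E * energy D P)%E.

Let inv_rate t : 0 <= t <= D -> (1 + P t)^-1 = beta + C * capped_exp b s t.
Proof. by move=> tD; rewrite PE// /exp_policy mul1r addrC subrK invrK. Qed.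

Let heatP_lty : (heat b P D < +oo)%E.
Proof. by rewrite heat_eq ?sD ?lexx// ltry. Qed.

Let heatQ u : s <= u <= D -> (heat b Q u <= heat b P u)%E.
Proof.
move=> /[dup] su /andP[su' uD]; have uD' : 0 <= u <= D by rewrite uD (le_trans s0).
by rewrite (heat_eq _ su) -(temperature_le _ _ _ _ D)//; [exact: feasQ.2|exact: feasQ.1].
Qed.

Lemma capped_throughput_max : (throughput D Q <= throughput D P)%E.
Proof.
exact: (verification_le b beta C s D P Q b0 beta0 C0 sD polP feasQ.1 inv_rate
  heatP_lty heatQ energyQ).
Qed.

Lemma capped_throughput_unique : (throughput D P <= throughput D Q)%E ->
  {ae mu, forall t : R, 0 <= t <= D -> Q t = P t}.
Proof.
exact: (verification_eq b beta C s D P Q b0 beta0 C0 sD polP feasQ.1 inv_rate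
  heatP_lty heatQ energyQ).
Qed.

End competitor.

Lemma capped_optimal (E : R) : energy D P = E%:E -> the_optimal_policy a b Te Tc D E P.
Proof.
move=> PEn.
have feasP : feasible a b Te Tc D E P by split; [exact: capped_temp_feasible|rewrite PEn].
have enQ Q : feasible a b Te Tc D E Q -> (beta%:E * energy D Q <= beta%:E * energy D P)%E.
  by move=> [_ QE]; rewrite lee_wpmul2l ?lee_fin// PEn.
split; first by split=> // Q fQ; exact: (capped_throughput_max Q fQ.1 (enQ _ fQ)).
move=> Q [fQ maxQ]; apply: (capped_throughput_unique Q fQ.1 (enQ _ fQ)).
exact: maxQ.
Qed.

Lemma capped_optimal_no_energy (Q : R -> R) : beta = 0 ->
  optimal_no_energy a b Te Tc D Q -> {ae mu, forall t : R, 0 <= t <= D -> Q t = P t}.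
Proof.
move=> be0 [fQ maxQ]; apply: capped_throughput_unique => //.
  by rewrite be0 !mul0e.
exact/maxQ/capped_temp_feasible.
Qed.

End capped_policy.

(** * Continuity of the energy integral in its parameters *)

(** With [r = beta / C] this is the integral of [1 / (beta + C e^{b t})] up to the factor [1 / C].
    Bounds and a Lipschitz estimate suffice, without a closed form. *)
Definition integral_inv {R : realType} (b r s : R) : R :=
  \int[lebesgue_measure]_(t in `[0, s]) (r + expR (b * t))^-1.

Section integral_inv.
Context {R : realType}.
Local Notation mu := (@lebesgue_measure R).
Variable b : R.
Hypothesis b0 : 0 < b.

Let den_gt0 (r t : R) : 0 <= r -> 0 < r + expR t.
Proof. by move=> r0; rewrite ltr_wpDl// expR_gt0. Qed.

Let den_inv_le1 (r t : R) : 0 <= r -> 0 <= t -> (r + expR (b * t))^-1 <= 1.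
Proof.
move=> r0 t0; rewrite invf_le1 ?den_gt0//.
have : 1 <= expR (b * t) by rewrite -expR0 ler_expR mulr_ge0// ltW.
by lra.
Qed.

Let continuous_inv (r : R) : 0 <= r -> continuous (fun t : R => (r + expR (b * t))^-1).
Proof.
move=> r0 x; apply: cvgV; first by rewrite lt0r_neq0// den_gt0.
by apply: cvgD; [exact: cvg_cst|exact: continuous_expRM].
Qed.

Let integrable_inv (r s s' : R) : 0 <= r ->
  mu.-integrable `[s, s'] (EFin \o (fun t => (r + expR (b * t))^-1)).
Proof.
move=> r0; apply: continuous_compact_integrable; first exact: segment_compact.
exact/continuous_subspaceT/continuous_inv.
Qed.

Let Rintegral_cst_itv (x s s' : R) : s <= s' ->
  \int[mu]_(t in `[s, s']) x = x * (s' - s).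
Proof.
rewrite le_eqVlt => /predU1P[<-|ss']; first by rewrite set_itv1 Rintegral_set1 subrr mulr0.
by rewrite Rintegral_cst//= lebesgue_measure_itv/= lte_fin ss'.
Qed.

Let integrable_cst (x s s' : R) : mu.-integrable `[s, s'] (EFin \o (fun=> x)).
Proof.
apply: continuous_compact_integrable; first exact: segment_compact.
by apply: continuous_subspaceT => ?; exact: cvg_cst.
Qed.

Lemma integral_inv_le (r s : R) : 0 <= r -> 0 <= s -> integral_inv b r s <= s / (r + 1).
Proof.
move=> r0 s0; have -> : s / (r + 1) = \int[mu]_(t in `[0, s]) (r + 1)^-1.
  by rewrite Rintegral_cst_itv// subr0 mulrC.
apply: le_Rintegral => //; [exact: integrable_inv|].
move=> t; rewrite /= in_itv/= => /andP[t0 _].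
have t1 : 1 <= expR (b * t) by rewrite -expR0 ler_expR mulr_ge0// ltW.
by rewrite lef_pV2 ?posrE ?den_gt0 ?ltr_wpDl// lerD2l.
Qed.

Let integral_inv_incr (r s s' : R) : 0 <= r -> 0 <= s -> s <= s' ->
  0 <= integral_inv b r s' - integral_inv b r s <= s' - s.
Proof.
move=> r0 s0 ss'.
have E : integral_inv b r s' - integral_inv b r s =
    \int[mu]_(t in `[s, s']) (r + expR (b * t))^-1.
  apply/eqP; rewrite subr_eq addrC; apply/eqP.
  rewrite /integral_inv /Rintegral (ge0_integral_itv_split _ 0 s s')//.
  - by rewrite fineD//; apply: integrable_fin_num => //; exact: integrable_inv.
  - by apply: measurable_funTS; apply: continuous_measurable_fun; exact: continuous_inv.
  - by move=> t _; rewrite invr_ge0 ltW// den_gt0.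
rewrite E; apply/andP; split.
  by apply: Rintegral_ge0 => t _; rewrite invr_ge0 ltW// den_gt0.
rewrite -[leRHS]mul1r -Rintegral_cst_itv//.
apply: le_Rintegral => //; [exact: integrable_inv|].
move=> t; rewrite /= in_itv/= => /andP[st _]; rewrite den_inv_le1//.
exact: le_trans st.
Qed.

Let integral_inv_lip2 (r s s' : R) : 0 <= r -> 0 <= s -> 0 <= s' ->
  `|integral_inv b r s - integral_inv b r s'| <= `|s - s'|.
Proof.
move=> r0 s0 s'0; have [ss'|/ltW ss'] := leP s s'.
  have /andP[h1 h2] := integral_inv_incr _ _ _ r0 s0 ss'.
  by rewrite distrC ger0_norm// distrC ger0_norm// subr_ge0.
have /andP[h1 h2] := integral_inv_incr _ _ _ r0 s'0 ss'.
by rewrite ger0_norm// ger0_norm// subr_ge0.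
Qed.

Let integral_inv_lip1 (r r' s : R) : 0 <= r -> 0 <= r' -> 0 <= s ->
  `|integral_inv b r s - integral_inv b r' s| <= `|r - r'| * s.
Proof.
move=> r0 r'0 s0.
have iB : mu.-integrable `[0, s] (EFin \o
    (fun t => (r + expR (b * t))^-1 - (r' + expR (b * t))^-1)).
  rewrite (_ : EFin \o _ = ((EFin \o (fun t => (r + expR (b * t))^-1)%R) \-
    (EFin \o (fun t => (r' + expR (b * t))^-1)%R))%E)//.
  by apply: integrableB => //; exact: integrable_inv.
rewrite /integral_inv -RintegralB//; [|exact: integrable_inv..].
apply: (le_trans (le_normr_Rintegral _ iB)) => //.
rewrite -{2}(subr0 s) -Rintegral_cst_itv//.
apply: le_Rintegral => //; [exact: integrable_norm|].
move=> t; rewrite /= in_itv/= => /andP[t0 _].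
have d1 := den_gt0 r (b * t) r0; have d2 := den_gt0 r' (b * t) r'0.
have -> : (r + expR (b * t))^-1 - (r' + expR (b * t))^-1 =
    (r' - r) * ((r + expR (b * t))^-1 * (r' + expR (b * t))^-1).
  by field; rewrite !lt0r_neq0.
rewrite normrM distrC ler_piMr// ger0_norm ?mulr_ge0 ?invr_ge0 ?(ltW d1) ?(ltW d2)//.
by rewrite mulr_ile1 ?invr_ge0 ?(ltW d1) ?(ltW d2) ?den_inv_le1.
Qed.

(** The integrand lies between 0 and 1 and is 1-Lipschitz in [r]; the estimate passes through the
    intermediate point [(r, s')]. *)
Lemma integral_inv_lip (r r' s s' : R) : 0 <= r -> 0 <= r' -> 0 <= s -> 0 <= s' ->
  `|integral_inv b r s - integral_inv b r' s'| <= `|r - r'| * s' + `|s - s'|.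
Proof.
move=> r0 r'0 s0 s'0.
have := integral_inv_lip1 r r' s' r0 r'0 s'0; have := integral_inv_lip2 r s s' r0 s0 s'0.
have := ler_normD (integral_inv b r s - integral_inv b r s') (integral_inv b r s' - integral_inv b r' s').
by rewrite addrA subrK; lra.
Qed.

Lemma continuous_integral_inv (r s : R -> R) (x : R) :
  (forall z, 0 <= r z) -> (forall z, 0 <= s z) ->
  {for x, continuous r} -> {for x, continuous s} ->
  {for x, continuous (fun z => integral_inv b (r z) (s z))}.
Proof.
move=> r0 s0 cr cs.
have h0 : (fun z => `|r z - r x| * s x + `|s z - s x|) @ x --> (0 : R).
  rewrite -[X in _ --> X](_ : `|r x - r x| * s x + `|s x - s x| = 0); last first.
    by rewrite !subrr normr0 mul0r addr0.
  apply: cvgD.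
    by apply: cvgM; [apply: cvg_norm; apply: cvgB => //; exact: cvg_cst|exact: cvg_cst].
  by apply: cvg_norm; apply: cvgB => //; exact: cvg_cst.
apply/cvgrPdist_le => e e0.
have /cvgrPdist_le/(_ e e0) := h0.
apply: filterS => z /=; rewrite sub0r normrN => h; rewrite distrC.
apply: (le_trans (integral_inv_lip _ _ _ _ (r0 z) (r0 x) (s0 z) (s0 x))).
exact: le_trans (ler_norm _) h.
Qed.

Lemma exp_policy_energyE (C r s : R) : 0 < C -> 0 <= r -> 0 <= s ->
  exp_policy_energy b (r * C) C s = integral_inv b r s / C - s.
Proof.
move=> C0 r0 s0; rewrite /exp_policy_energy /integral_inv.
have -> : \int[mu]_(t in `[0, s]) exp_policy b (r * C) C t =
    \int[mu]_(t in `[0, s]) (C^-1 * (r + expR (b * t))^-1 - 1).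
  apply: eq_Rintegral => t _; rewrite /exp_policy.
  have d := den_gt0 r (b * t) r0.
  have -> : r * C + C * expR (b * t) = C * (r + expR (b * t)) by ring.
  by rewrite invfM mul1r.
rewrite RintegralB//; last first.
  rewrite (_ : EFin \o _ = (fun t => (C^-1)%R%:E * ((r + expR (b * t))^-1)%R%:E)%E)//.
  by apply: integrableZl => //; exact: integrable_inv.
rewrite Rintegral_cst_itv// RintegralZl//; last exact: integrable_inv.
by rewrite mul1r subr0 mulrC.
Qed.

End integral_inv.

(** * The function governing the curve of candidates *)

(** The integral of [ln] from 1 to [z]. *)
Definition ln_gap {R : realType} (z : R) : R := 1 - z + z * ln z.

Section ln_gap.
Context {R : realType}.

(** Multiplying [ln (z' / z) > 1 - z / z'] by [z'] shows that the increment exceeds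
    [(z' - z) ln z >= 0]. *)
Lemma ln_gap_lt (z z' : R) : 1 <= z -> z < z' -> ln_gap z < ln_gap z'.
Proof.
move=> z1 zz'; have z0 : 0 < z by lra.
have z'0 : 0 < z' by lra.
have := @ln_gt1BV R (z' / z) (divr_gt0 z'0 z0).
rewrite invf_div => /(_ _)/wrap[].
  apply/negP => /eqP h; have : z' = z by rewrite -(divfK (lt0r_neq0 z0) z') h mul1r.
  by lra.
rewrite ln_div ?posrE// -(ltr_pM2l z'0) mulrBr mulr1 [z' * (z / z')]mulrC divfK ?lt0r_neq0//.
have l0 := ln_ge0 z1; rewrite /ln_gap => h.
have : 0 <= (z' - z) * ln z by rewrite mulr_ge0 // subr_ge0 ltW.
by rewrite mulrBr in h; rewrite mulrBl; lra.
Qed.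

Lemma ln_gap1 : ln_gap 1 = 0 :> R.
Proof. by rewrite /ln_gap ln1; ring. Qed.

Lemma ln_gap_gt0 (z : R) : 1 < z -> 0 < ln_gap z.
Proof. by move=> z1; rewrite -ln_gap1 ln_gap_lt. Qed.

(** The quadratic bound makes [curve_q z * (z - 1)] unbounded as [z] decreases to 1. *)
Lemma ln_gap_le (z : R) : 1 <= z -> ln_gap z <= (z - 1) ^+ 2.
Proof.
move=> z1; have h : ln z <= z - 1.
  by have := @le_ln1Dx R (z - 1); rewrite [1 + _]addrC subrK; apply; lra.
have : z * ln z <= z * (z - 1) by rewrite ler_pM2l//; lra.
by rewrite /ln_gap expr2; lra.
Qed.

Lemma continuous_ln_gap (z : R) : 0 < z -> {for z, continuous (@ln_gap R)}.
Proof.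
move=> z0; apply: cvgD; first by apply: cvgB; [exact: cvg_cst|exact: cvg_id].
by apply: cvgM; [exact: cvg_id|exact: continuous_ln].
Qed.

(** Intermediate values between [ln_gap 1 = 0] and [ln_gap e = 1]. For [m = c / (c + 1)] this is the
    end of the curve where [beta = 0]. *)
Lemma ln_gap_preimage (m : R) : 0 < m -> m < 1 -> exists2 z : R, 1 < z & ln_gap z = m.
Proof.
move=> m0 m1; have e1 : 1 < expR 1 :> R by rewrite expR_gt1.
have ge1 : ln_gap (expR 1) = 1 :> R by rewrite /ln_gap expRK; ring.
have [|||z] := @IVT R (@ln_gap R) 1 (expR 1) m; rewrite ?(ltW e1)//.
- apply: continuous_in_subspaceT => z /set_mem; rewrite /= in_itv/= => /andP[z1 _].
  by apply: continuous_ln_gap; lra.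
- by rewrite ln_gap1 ge1 ge_min le_max (ltW m0) (ltW m1) orbT.
rewrite in_itv/= => /andP[]; rewrite le_eqVlt => /predU1P[<- _|z1 _ zm]; last by exists z.
by rewrite ln_gap1 => h; move: m0; rewrite -h ltxx.
Qed.

End ln_gap.

(** * The curve of candidates and its level condition *)

Section curve.
Context {R : realType}.
Variables (b c D : R).
Hypotheses (b0 : 0 < b) (c0 : 0 < c) (D0 : 0 < D).

(* With [q = 1 + beta / C] and [z = (beta + C e^{b s}) / (beta + C)], the
   temperature equation at [s] and the level equation
   [(c + 1) (beta + C e^{b s}) = 1] together give
   [q * ln_gap z = c / (c + 1)] and [e^{b s} = 1 + q (z - 1)].  When this [s]
   exceeds [D], it is replaced by [D], and [C] is determined by the temperature
   equation alone. *)
Definition curve_q (z : R) : R := c / (c + 1) / ln_gap z.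
Definition curve_X (z : R) : R := Num.min (expR (b * D)) (1 + curve_q z * (z - 1)).
Definition curve_s (z : R) : R := ln (curve_X z) / b.
Definition curve_C (z : R) : R :=
  ln ((curve_q z - 1 + curve_X z) / curve_q z) / ((c + 1) * curve_X z - 1).

Let eD1 : 1 < expR (b * D).
Proof. by rewrite expR_gt1 mulr_gt0. Qed.

Variable z : R.
Hypothesis z1 : 1 < z.

Let q := curve_q z.
Let X := curve_X z.
Let s := curve_s z.
Let C := curve_C z.

Lemma curve_q_gt0 : 0 < q.
Proof. by rewrite /q /curve_q !divr_gt0 ?ln_gap_gt0// addr_gt0. Qed.
Let q0 : 0 < q.
Proof. exact: curve_q_gt0. Qed.

Lemma curve_X_gt1 : 1 < X.
Proof. by rewrite /X /curve_X lt_min eD1 ltrDl mulr_gt0// subr_gt0. Qed.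
Let X1 : 1 < X.
Proof. exact: curve_X_gt1. Qed.

Lemma expR_curve_s : expR (b * s) = X.
Proof.
rewrite /s /curve_s mulrC divfK ?lt0r_neq0// lnK// posrE -/X; exact: lt_trans X1.
Qed.

Lemma curve_s_gt0 : 0 < s.
Proof. by rewrite /s divr_gt0// ln_gt0. Qed.

Lemma curve_s_le : s <= D.
Proof.
rewrite -(ler_pM2l b0) -ler_expR expR_curve_s /X /curve_X; by rewrite ge_min lexx.
Qed.

Let den_gt0 : 0 < (c + 1) * X - 1.
Proof.
have c0' := c0; have : 1 * X < (c + 1) * X by rewrite ltr_pM2r; [lra|exact: lt_trans X1].
by have := X1; lra.
Qed.

Lemma curve_C_gt0 : 0 < C.
Proof.
rewrite /C /curve_C divr_gt0// ln_gt0// ltr_pdivlMr// mul1r.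
by have := X1; rewrite -/q -/X -/q; lra.
Qed.

Lemma curve_tight : ln ((q - 1 + X) / q) = C * ((c + 1) * X - 1).
Proof. by rewrite /C /curve_C divfK// lt0r_neq0. Qed.

Let gapE : (c + 1) * (q * ln_gap z) = c.
Proof.
have c0' := c0; rewrite /q /curve_q; field; rewrite !lt0r_neq0 ?ln_gap_gt0//; lra.
Qed.

(** Here [X = 1 + q (z - 1)], so tightness reads [ln z = C ((c + 1) X - 1)]. By [gapE],
    [(c + 1) q z ln z = (c + 1) X - 1]; cancelling this positive factor gives the level equation. *)
Lemma curve_level_eq : s < D -> (c + 1) * (C * (q - 1 + X)) = 1.
Proof.
move=> sD; have : X < expR (b * D) by rewrite -expR_curve_s ltr_expR ltr_pM2l.
rewrite {1}/X /curve_X gt_min ltxx/= => lt_X1.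
have XE : X = 1 + q * (z - 1) by rewrite /X /curve_X min_r ?(ltW lt_X1).
have := den_gt0; have := curve_tight; rewrite XE.
have -> : (q - 1 + (1 + q * (z - 1))) / q = z by field; rewrite lt0r_neq0.
move=> lnz dpos.
have : C * ((c + 1) * X - 1) * (q * z * (c + 1)) = (c + 1) * X - 1.
  rewrite XE -lnz; have := gapE; rewrite /ln_gap => g.
  have -> : ln z * (q * z * (c + 1)) =
    (c + 1) * (q * (1 - z + z * ln z)) + (c + 1) * (q * (z - 1)) by ring.
  by rewrite g; ring.
move=> h; apply: (mulfI (lt0r_neq0 dpos)); rewrite mulr1 -XE -[RHS]h.
have -> : q - 1 + X = q * z by rewrite XE; ring.
by ring.
Qed.

(** When [s = D], tightness gives [ln (y1 / y) = ln z - C d], and [ln x >= 1 - 1 / x] bounds [C d]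
    from above. Eliminating [ln z] leaves [(c + 1) C y d <= d y / y1 <= d]. *)
Lemma curve_level_le : (c + 1) * (C * (q - 1 + X)) <= 1.
Proof.
have c0' := c0; have z1' := z1; have q0' := q0; have X1' := X1.
have [sD|Ds] := ltP s D; first by rewrite curve_level_eq.
have XE : X = expR (b * D).
  by rewrite -expR_curve_s; congr (expR (b * _)); apply/le_anti; rewrite curve_s_le.
have leX : X <= 1 + q * (z - 1) by rewrite /X /curve_X ge_min lexx orbT.
(* [y] is the value of [(beta + C e^{b t}) / C] at [D], [y1] the value for which
   the level condition is an equality. *)
pose y := q - 1 + X; pose y1 := q * z.
have y_gt : q < y by rewrite /y; have := X1; lra.
have yy1 : y <= y1.
  have -> : y1 = q - 1 + (1 + q * (z - 1)) by rewrite /y1; ring.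
  by rewrite lerD2l.
have y0 : 0 < y by exact: lt_trans y_gt.
have y10 : 0 < y1 by exact: lt_le_trans yy1.
have := @ln_ge1BV R (y1 / y) (divr_gt0 y10 y0); rewrite invf_div.
have -> : y1 / y = z / (y / q) by rewrite /y1; field; rewrite !lt0r_neq0.
have z0 : 0 < z by lra.
pose d := (c + 1) * X - 1.
have d0 : 0 < d by exact: den_gt0.
have lnyE : ln (y / q) = C * d by exact: curve_tight.
have yq0 : 0 < y / q by exact: divr_gt0.
rewrite ln_div ?posrE// lnyE => h1.
have gE : (c + 1) * (y1 * ln z - (y1 - q + 1)) = -1.
  have -> : (c + 1) * (y1 * ln z - (y1 - q + 1)) =
    (c + 1) * (q * ln_gap z) - (c + 1) by rewrite /y1 /ln_gap; ring.
  by rewrite gapE; ring.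
suff : (c + 1) * (C * y) * d <= 1 * d by rewrite ler_pM2r.
rewrite mul1r.
have -> : (c + 1) * (C * y) * d = (c + 1) * (C * d * y) by ring.
have h2 : C * d <= ln z - (1 - y / y1) by lra.
have h3 : (c + 1) * (C * d * y) <= (c + 1) * ((ln z - (1 - y / y1)) * y).
  by rewrite ler_pM2l ?ler_pM2r//; lra.
apply: le_trans h3 _.
(* The identity [gapE] solved for [ln z]. *)
have lnzE : ln z = (y1 - q + 1 - (c + 1)^-1) / y1.
  apply: (mulIf (lt0r_neq0 y10)); rewrite divfK ?lt0r_neq0//.
  have c1 : c + 1 != 0 by rewrite lt0r_neq0; lra.
  apply: (mulfI c1); rewrite [RHS]mulrBr divff//.
  have -> : (c + 1) * (ln z * y1) = (c + 1) * (y1 * ln z - (y1 - q + 1)) + (c + 1) * (y1 - q + 1).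
    by ring.
  by rewrite gE; ring.
have -> : (ln z - (1 - y / y1)) * y = (y - q + 1 - (c + 1)^-1) * (y / y1).
  by rewrite lnzE; field; rewrite !lt0r_neq0//; lra.
have -> : d = (c + 1) * (y - q + 1 - (c + 1)^-1).
  rewrite /d /y; field; rewrite lt0r_neq0//; lra.
rewrite ler_pM2l; last lra.
rewrite ler_piMr ?ler_pdivrMr ?mul1r//.
have : (c + 1)^-1 <= 1 by rewrite invf_le1; lra.
lra.
Qed.

End curve.

(* The truncations by [Num.max 0] are inactive on the range [1 < z], [1 <= curve_q z]
   of interest. *)
Definition curve_energy {R : realType} (b c D z : R) : R :=
  integral_inv b (Num.max (curve_q c z - 1) 0) (Num.max (curve_s b c D z) 0) /
    curve_C b c D z - curve_s b c D z + c * (D - curve_s b c D z).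

(** * Energy along the curve: continuity and behaviour near 1 *)

Section curve_continuity.
Context {R : realType}.
Variables (b c D z : R).
Hypotheses (b0 : 0 < b) (c0 : 0 < c) (D0 : 0 < D) (z1 : 1 < z).

Let continuous_q : {for z, continuous (curve_q c)}.
Proof.
have z1' := z1; apply: cvgM; first exact: cvg_cst.
apply: cvgV; first by rewrite lt0r_neq0// ln_gap_gt0.
by apply: continuous_ln_gap; lra.
Qed.

Let continuous_X : {for z, continuous (curve_X b c D)}.
Proof.
apply: (@continuous_min _ _ (fun=> expR (b * D)) (fun z => 1 + curve_q c z * (z - 1))).
  exact: cvg_cst.
apply: cvgD; first exact: cvg_cst.
by apply: cvgM => //; apply: cvgB; [exact: cvg_id|exact: cvg_cst].
Qed.

Let q_gt0 := curve_q_gt0 c c0 z z1.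
Let X_gt1 := curve_X_gt1 b c D b0 c0 D0 z z1.

Let continuous_s : {for z, continuous (curve_s b c D)}.
Proof.
apply: cvgM; last exact: cvg_cst.
apply: continuous_comp; first exact: continuous_X.
by apply: continuous_ln; exact: lt_trans X_gt1.
Qed.

Let continuous_C : {for z, continuous (curve_C b c D)}.
Proof.
have c0' := c0; have X1 := X_gt1; have q0 := q_gt0.
have den : 0 < (c + 1) * curve_X b c D z - 1.
  have -> : (c + 1) * curve_X b c D z - 1 = c * curve_X b c D z + (curve_X b c D z - 1) by ring.
  by rewrite addr_gt0 ?subr_gt0// mulr_gt0//; lra.
apply: cvgM.
  apply: continuous_comp.
    apply: cvgM; last by apply: cvgV => //; rewrite lt0r_neq0.
    by apply: cvgD => //; apply: cvgB => //; exact: cvg_cst.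
  by apply: continuous_ln; rewrite divr_gt0//; lra.
apply: cvgV; first by rewrite lt0r_neq0.
by apply: cvgB; [apply: cvgM => //; exact: cvg_cst|exact: cvg_cst].
Qed.

Lemma continuous_curve_energy : {for z, continuous (curve_energy b c D)}.
Proof.
apply: cvgD; last first.
  by apply: cvgM; [exact: cvg_cst|apply: cvgB => //; exact: cvg_cst].
apply: cvgB => //; apply: cvgM; last first.
  by apply: cvgV => //; rewrite lt0r_neq0// curve_C_gt0.
apply: (@continuous_integral_inv R b b0 (fun z => Num.max (curve_q c z - 1) 0)
  (fun z => Num.max (curve_s b c D z) 0)) => [?|?||].
- by rewrite le_max lexx orbT.
- by rewrite le_max lexx orbT.
- apply: (@continuous_max _ _ (fun z => curve_q c z - 1) (fun=> 0)); last exact: cvg_cst.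
  by apply: cvgB => //; exact: cvg_cst.
- by apply: (@continuous_max _ _ (curve_s b c D) (fun=> 0)) => //; exact: cvg_cst.
Qed.

Lemma curve_energyE : 1 <= curve_q c z -> curve_energy b c D z =
  exp_policy_energy b ((curve_q c z - 1) * curve_C b c D z) (curve_C b c D z)
    (curve_s b c D z) + c * (D - curve_s b c D z).
Proof.
move=> q1; have s0 := curve_s_gt0 b c D b0 c0 D0 z z1.
rewrite exp_policy_energyE ?curve_C_gt0 ?subr_ge0 ?(ltW s0)//.
by rewrite /curve_energy !max_l ?subr_ge0 ?(ltW s0).
Qed.

End curve_continuity.

(* As [z -> 1] the policy tends to the constant one, which uses the energy
   [E_critical]. *)
Lemma curve_energy_near1 {R : realType} (b c D E z : R) :
  0 < b -> 0 < c -> 0 < D -> 1 < z -> z <= 2 -> 1 <= curve_q c z ->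
  let eD := expR (b * D) in
  let A := D * ((c + 1) * eD - 1) / (eD - 1) in
  (z - 1) * (eD - 1) <= c / (c + 1) ->
  A * (eD - 1) * (z - 1) <= (E + D - A) * (c / (c + 1)) ->
  curve_energy b c D z <= E.
Proof.
move=> b0 c0 D0 z1 z2 q1 eD A h1 h2.
have eD1 : 1 < eD by rewrite /eD expR_gt1 mulr_gt0.
set m := c / (c + 1) in h1 h2 *.
have m0 : 0 < m by rewrite divr_gt0//; lra.
have g0 := ln_gap_gt0 z z1.
have gle : ln_gap z <= (z - 1) ^+ 2 by exact/ln_gap_le/ltW.
set q := curve_q c z in q1 *.
have q0 : 0 < q by lra.
have qg : q * ln_gap z = m by rewrite /q /curve_q divfK// lt0r_neq0.
have qz : m <= q * (z - 1) ^+ 2 by rewrite -qg ler_pM2l.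
have d0 : 0 < z - 1 by lra.
(* Since [q (z - 1) >= m / (z - 1) >= eD - 1], the cap in [curve_X] is active, and the switching
   time is [D]. *)
have XE : curve_X b c D z = eD.
  rewrite /curve_X min_l// -/eD -/q -lerBlDl -(ler_pM2r d0) -mulrA -expr2.
  by apply: le_trans qz; rewrite mulrC.
have sE : curve_s b c D z = D.
  by rewrite /curve_s XE /eD expRK mulrC mulKf// lt0r_neq0.
rewrite /curve_energy sE subrr mulr0 addr0 -/q !max_l ?(ltW D0) ?subr_ge0// lerBlDr.
have C0 := curve_C_gt0 b c D b0 c0 D0 z z1.
have dpos : 0 < (c + 1) * eD - 1.
  have -> : (c + 1) * eD - 1 = c * eD + (eD - 1) by ring.
  by rewrite addr_gt0 ?subr_gt0// mulr_gt0//; lra.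
have qeD : 0 < q - 1 + eD by lra.
have lnq := @ln_ge1BV R ((q - 1 + eD) / q) (divr_gt0 qeD q0).
rewrite invf_div in lnq.
(* A lower bound on [curve_C], from [ln x >= 1 - 1 / x], bounds the energy from above. *)
have Cge : (eD - 1) / (q - 1 + eD) / ((c + 1) * eD - 1) <= curve_C b c D z.
  rewrite /curve_C XE -/q ler_pM2r ?invr_gt0//.
  apply: le_trans lnq; rewrite le_eqVlt; apply/orP; left; apply/eqP.
  by field; rewrite lt0r_neq0.
have J : integral_inv b (q - 1) D <= D / q.
  by have := @integral_inv_le R b b0 (q - 1) D; rewrite subrK subr_ge0; apply=> //; exact: ltW.
have step1 : integral_inv b (q - 1) D / curve_C b c D z <= A * ((q - 1 + eD) / q).
  rewrite ler_pdivrMr//; apply: (le_trans J).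
  have -> : D / q = A * ((q - 1 + eD) / q) * ((eD - 1) / (q - 1 + eD) / ((c + 1) * eD - 1)).
    rewrite /A; field; rewrite !lt0r_neq0//; lra.
  rewrite ler_pM2l// mulr_gt0// divr_gt0//; last lra.
  by rewrite mulr_gt0.
apply: (le_trans step1).
have A0 : 0 < A by rewrite divr_gt0 ?mulr_gt0// subr_gt0.
(* The limit energy is [A - D]. The excess is of order [1 / q], and [m / q <= (z - 1)^2 <= z - 1]
   lets the second smallness condition absorb it. *)
suff : A * (eD - 1) / q <= E + D - A.
  have -> : A * ((q - 1 + eD) / q) = A + A * (eD - 1) / q by field; rewrite lt0r_neq0.
  by lra.
rewrite -(ler_pM2r m0); apply: le_trans h2.
have -> : A * (eD - 1) / q * m = A * (eD - 1) * (m / q) by ring.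
rewrite ler_pM2l; last by rewrite mulr_gt0 ?subr_gt0.
rewrite ler_pdivrMr// mulrC; apply: (le_trans qz).
by rewrite ler_pM2l// expr2 ler_piMr ?(ltW d0)//; lra.
Qed.

(** * Invariance under almost everywhere equality *)

Section ae_policy.
Context {R : realType}.
Variables (D : R) (P Q : R -> R).
Hypotheses (polP : power_policy D P) (polQ : power_policy D Q).
Hypothesis PQ : {ae lebesgue_measure, forall t : R, 0 <= t <= D -> P t = Q t}.

Lemma ae_eq_energy : energy D P = energy D Q.
Proof.
apply: ae_eq_integral => //.
- by apply/measurable_EFinP; exact: polP.1.
- by apply/measurable_EFinP; exact: polQ.1.
- move: PQ; apply: (@filterS _ _ (ae_filter_ringOfSetsType (@lebesgue_measure R))).
  by move=> t h; rewrite /= in_itv/= => /h ->.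
Qed.

Lemma ae_eq_heat (b t : R) : t <= D -> heat b P t = heat b Q t.
Proof.
move=> tD.
have sub : `[0, t] `<=` `[0, D].
  by move=> x; rewrite /= !in_itv/= => /andP[-> xt]/=; exact: le_trans tD.
apply: ae_eq_integral => //.
- apply/measurable_EFinP; apply: measurable_funS (measurable_expRM_policy b D P polP.1) => //.
- apply/measurable_EFinP; apply: measurable_funS (measurable_expRM_policy b D Q polQ.1) => //.
- move: PQ; apply: (@filterS _ _ (ae_filter_ringOfSetsType (@lebesgue_measure R))).
  by move=> x h /sub; rewrite /= in_itv/= => /h ->.
Qed.

End ae_policy.

(** * Optimality along the curve and attainment of the energy *)

Section curve_policy.
Context {R : realType}.
Variables (a b Te Tc D : R).
Hypotheses (a0 : 0 < a) (b0 : 0 < b) (TeTc : Te < Tc) (D0 : 0 < D).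

Let c := (Tc - Te) * b / a.

Lemma steady_power_gt0 : 0 < c.
Proof. by rewrite !mulr_gt0 ?invr_gt0// subr_gt0. Qed.
Let c0 := steady_power_gt0.

Section point.
Variable z : R.
Hypotheses (z1 : 1 < z) (q1 : 1 <= curve_q c z).

Let s := curve_s b c D z.
Let C := curve_C b c D z.
Let beta := (curve_q c z - 1) * C.

Let C0 : 0 < C.
Proof. exact: curve_C_gt0. Qed.

Let s0 : 0 < s.
Proof. exact: curve_s_gt0. Qed.

Let sD : s <= D.
Proof. exact: curve_s_le. Qed.

Let beta0 : 0 <= beta.
Proof. by rewrite mulr_ge0 ?subr_ge0// ltW. Qed.

Let levelE : beta + C * expR (b * s) = C * (curve_q c z - 1 + curve_X b c D z).
Proof. by rewrite expR_curve_s// /beta; ring. Qed.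

Lemma curve_policy_level_le : (c + 1) * (beta + C * expR (b * s)) <= 1.
Proof. by rewrite levelE curve_level_le. Qed.

Lemma curve_policy_level_eq : s < D -> (c + 1) * (beta + C * expR (b * s)) = 1.
Proof. by move=> sD'; rewrite levelE curve_level_eq. Qed.

Lemma curve_policy_temperature : exp_policy_temperature a b Te beta C s = Tc.
Proof.
have q0 := curve_q_gt0 c c0 z z1.
have X0 : 0 < curve_X b c D z by exact: lt_trans (curve_X_gt1 b c D b0 c0 D0 z z1).
rewrite exp_policy_temperatureE ?(ltW s0)// levelE.
have -> : beta + C = C * curve_q c z by rewrite /beta; ring.
rewrite -mulf_div divff ?lt0r_neq0// mul1r curve_tight// -/C expRN expR_curve_s//.
by rewrite /c; field; rewrite !lt0r_neq0.
Qed.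

Lemma curve_policy_optimal (E : R) : curve_energy b c D z = E -> s = D ->
  the_optimal_policy a b Te Tc D E (exp_policy b beta C).
Proof.
move=> zE sDE.
have PE t : 0 <= t <= D -> exp_policy b beta C t = exp_policy b beta C (Num.min s t).
  by move=> /andP[_ tD]; rewrite sDE (min_idPr tD).
apply: (capped_optimal a b Te Tc D s beta C) => //.
- exact: ltW.
- exact: curve_policy_level_le.
- exact: curve_policy_level_eq.
- exact: curve_policy_temperature.
rewrite (capped_energy a b Te Tc D s beta C) ?(ltW s0)//;
  [|exact: curve_policy_level_le|exact: curve_policy_level_eq].
by rewrite -zE curve_energyE.
Qed.

(** At [curve_q c z = 1] the price [beta] is 0, so the candidate agrees almost everywhere with any
    optimum without energy constraint and has the same energy. *)
Lemma curve_policy_no_energy (P : R -> R) : curve_q c z = 1 ->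
  optimal_no_energy a b Te Tc D P -> energy D P = (curve_energy b c D z)%:E.
Proof.
move=> qE optP.
pose Q t := exp_policy b beta C (Num.min s t).
have QE t : 0 <= t <= D -> Q t = exp_policy b beta C (Num.min s t) by [].
have feasQ : temp_feasible a b Te Tc D Q.
  apply: (capped_temp_feasible a b Te Tc D s beta C) => //.
  - exact: ltW.
  - exact: curve_policy_level_le.
  - exact: curve_policy_level_eq.
  - exact: curve_policy_temperature.
have PQ : {ae lebesgue_measure, forall t : R, 0 <= t <= D -> P t = Q t}.
  apply: (capped_optimal_no_energy a b Te Tc D s beta C) => //.
  - exact: ltW.
  - exact: curve_policy_level_le.
  - exact: curve_policy_level_eq.
  - exact: curve_policy_temperature.
  - by rewrite /beta qE subrr mul0r.
rewrite (ae_eq_energy D P Q)//; [|exact: optP.1.1|exact: feasQ.1].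
rewrite (capped_energy a b Te Tc D s beta C) ?(ltW s0)//;
  [|exact: curve_policy_level_le|exact: curve_policy_level_eq].
by rewrite curve_energyE.
Qed.

End point.

Lemma curve_energy_surj (E : R) (P : R -> R) :
  optimal_no_energy a b Te Tc D P -> E_critical a b Te Tc D < E ->
  (E%:E < energy D P)%E ->
  exists z, [/\ 1 < z, 1 < curve_q c z & curve_energy b c D z = E].
Proof.
move=> optP Ecrit Ebar; have c0' := c0; have D0' := D0.
pose m := c / (c + 1).
have m0 : 0 < m by rewrite divr_gt0//; lra.
have m1 : m < 1 by rewrite /m ltr_pdivrMr; lra.
(* The endpoint with [curve_q c zm = 1], where the energy is that of [P] and exceeds [E]. *)
have [zm zm1 zmE] := ln_gap_preimage m m0 m1.
have qzm : curve_q c zm = 1 by rewrite /curve_q zmE -/m divff// lt0r_neq0.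
have Ezm : E < curve_energy b c D zm.
  by rewrite -lte_fin -(curve_policy_no_energy zm zm1 _ P)// qzm.
have q_gt1 z : 1 < z -> z < zm -> 1 < curve_q c z.
  move=> z1 zzm; rewrite /curve_q -/m ltr_pdivlMr ?ln_gap_gt0// mul1r -zmE.
  by rewrite ln_gap_lt// ltW.
pose eD := expR (b * D); pose A := D * ((c + 1) * eD - 1) / (eD - 1).
have eD1 : 0 < eD - 1 by rewrite subr_gt0 /eD expR_gt1 mulr_gt0.
have AE : A = E_critical a b Te Tc D + D.
  by rewrite /A /E_critical -/c -/eD; field; rewrite lt0r_neq0.
have A0 : 0 < A.
  rewrite AE addr_gt0// /E_critical -/eD -/c.
  apply: (mulr_gt0 c0); apply: divr_gt0 => //; apply: mulr_gt0 => //; exact: expR_gt0.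
have EA : 0 < E + D - A by rewrite AE; lra.
(* The four bounds give, in order, [1 + d <= 2], [1 + d <= zm] and the two smallness conditions of
   [curve_energy_near1]. *)
pose d := Num.min (Num.min 1 (zm - 1))
  (Num.min (m / (eD - 1)) ((E + D - A) * m / (A * (eD - 1)))).
have d0 : 0 < d.
  rewrite !lt_min ltr01 subr_gt0 zm1/=; apply/andP; split; apply: divr_gt0 => //;
    exact: mulr_gt0.
have d1 : d <= 1 by rewrite /d !ge_min lexx.
have dzm : d <= zm - 1 by rewrite /d !ge_min lexx orbT.
have dm : d <= m / (eD - 1) by rewrite /d !ge_min lexx !orbT.
have dE : d <= (E + D - A) * m / (A * (eD - 1)) by rewrite /d !ge_min lexx !orbT.
have [z1 z1E] : exists z1, z1 = 1 + d by exists (1 + d).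
have z1zm : z1 <= zm by lra.
have z1_gt1 : 1 < z1 by lra.
have Ez1 : curve_energy b c D z1 <= E.
  apply: curve_energy_near1 => //; first by lra.
  - move: z1zm; rewrite le_eqVlt => /predU1P[->|z1zm]; first by rewrite qzm.
    exact/ltW/q_gt1.
  - by rewrite -ler_pdivlMr// z1E addrC addKr.
  - rewrite -/eD -/A -/m z1E (addrC 1) addrK mulrC -ler_pdivlMr//; exact: mulr_gt0.
have [||z zin zE] := @IVT R (curve_energy b c D) z1 zm E z1zm.
- apply: continuous_in_subspaceT => z /set_mem; rewrite /= in_itv/= => /andP[z1z _].
  by apply: continuous_curve_energy => //; exact: lt_le_trans z1z.
- by rewrite ge_min le_max Ez1 (ltW Ezm) orbT.
move: zin; rewrite in_itv/= => /andP[z1z zzm].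
have z_gt1 : 1 < z by exact: lt_le_trans z1z.
exists z; split=> //; apply: q_gt1 => //.
(* The energy at [zm] is strictly above [E], so [z] differs from [zm]; this makes [beta]
   positive. *)
rewrite lt_neqAle zzm andbT; apply/eqP => zzmE.
by move: Ezm; rewrite -zzmE zE ltxx.
Qed.

End curve_policy.

(** * Both cases deduced from the capped policies *)

Theorem mainTheorem8 (R : realType) (a b Te Tc D E : R) (Pbar : R -> R)
    (ha : 0 < a) (hb : 0 < b) (hT : Te < Tc) (hD : 0 < D) (hE : 0 < E)
    (hPbar : optimal_no_energy a b Te Tc D Pbar)
    (hEcrit : E_critical a b Te Tc D < E)
    (hEbar : (E%:E < energy D Pbar)%E) :
  (forall t0 beta C : R,
     0 < t0 -> t0 <= D -> 0 < beta -> 0 < C ->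
     switching_equations a b Te Tc D E t0 beta C ->
     the_optimal_policy a b Te Tc D E (switching_policy a b Te Tc t0 beta C))
  /\
  (~ (exists t0 beta C : R,
        [/\ 0 < t0 <= D, 0 < beta, 0 < C &
            switching_equations a b Te Tc D E t0 beta C]) ->
   (forall P : R -> R, optimal a b Te Tc D E P ->
      forall t : R, 0 <= t <= D -> (temp_tight a b Te Tc P t <-> t = D))
   /\
   (exists beta C : R,
      [/\ 0 < beta, 0 < C,
          exp_policy_temperature a b Te beta C D = Tc,
          exp_policy_energy b beta C D = E &
          the_optimal_policy a b Te Tc D E (exp_policy b beta C)])).
Proof.
have c0 := steady_power_gt0 a b Te Tc ha hb hT.
have c10 : (Tc - Te) * b / a + 1 != 0 by rewrite lt0r_neq0// addr_gt0.
split.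
  move=> t0 beta C t00 t0D beta0 C0 [level temp en].
  have y0 : beta + C * expR (b * t0) != 0 by rewrite lt0r_neq0// mixed_gt0// ltW.
  have level1 : ((Tc - Te) * b / a + 1) * (beta + C * expR (b * t0)) = 1.
    by rewrite -level divfK.
  (* By the level equation the constant tail is the value of the exponential policy at [t0]. *)
  have PE t : 0 <= t <= D -> switching_policy a b Te Tc t0 beta C t =
      exp_policy b beta C (Num.min t0 t).
    move=> _; rewrite /switching_policy; case: ltP => // _.
    by rewrite /exp_policy level addrK.
  apply: (capped_optimal a b Te Tc D t0 beta C) => //; rewrite ?level1 ?(ltW t00) ?(ltW beta0)//.
  by rewrite (capped_energy a b Te Tc D t0 beta C) ?en ?level1 ?(ltW t00) ?(ltW beta0).
move=> noswitch.
have [z [z1 q1 zE]] := curve_energy_surj a b Te Tc D ha hb hT hD E Pbar hPbar hEcrit hEbar.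
set c := (Tc - Te) * b / a in c0 c10 q1 zE.
pose s := curve_s b c D z; pose C := curve_C b c D z; pose beta := (curve_q c z - 1) * C.
have C0 : 0 < C by exact: curve_C_gt0.
have beta0 : 0 < beta by rewrite mulr_gt0// subr_gt0.
have s0 : 0 < s by exact: curve_s_gt0.
have sD : s <= D by exact: curve_s_le.
have temp : exp_policy_temperature a b Te beta C s = Tc by apply: curve_policy_temperature => //; exact: ltW.
have en : exp_policy_energy b beta C s + c * (D - s) = E.
  by rewrite -zE curve_energyE// ltW.
(* A switching time below [D] would give the level equation, hence a solution of the switching
   equations. *)
have sDE : s = D.
  move: sD; rewrite le_eqVlt => /predU1P[//|sltD].
  exfalso; apply: noswitch; exists s, beta, C; split=> //.
    by rewrite s0 ltW.
  split=> //; rewrite -/c; apply: (mulIf (lt0r_neq0 (mixed_gt0 _ _ (b * s) (ltW beta0) C0))).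
  rewrite divfK ?lt0r_neq0 ?mixed_gt0 ?(ltW beta0)//.
  by rewrite curve_policy_level_eq// ltW.
have opt : the_optimal_policy a b Te Tc D E (exp_policy b beta C).
  by apply: curve_policy_optimal => //; exact: ltW.
have PE t : 0 <= t <= D -> exp_policy b beta C t = exp_policy b beta C (Num.min s t).
  by move=> /andP[_ tD]; rewrite sDE (min_idPr tD).
split; last first.
  exists beta, C; split=> //; first by rewrite -sDE.
  by move: en; rewrite sDE subrr mulr0 addr0.
move=> P optP t tD.
have polP : power_policy D P := optP.1.1.1.
have polexp : power_policy D (exp_policy b beta C) := opt.1.1.1.1.
have PQ := opt.2 P optP.
(* Tightness depends only on the heat, which is unchanged on null sets, so it can be read off the
   exponential policy. *)
rewrite (temp_tightE _ _ _ _ D)// (ae_eq_heat D P (exp_policy b beta C))//; last first.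
  by case/andP : tD.
rewrite -(temp_tightE a b Te Tc D)//.
rewrite (capped_temp_tight a b Te Tc D s beta C) ?(ltW s0) ?(ltW beta0)//.
- rewrite sDE; split=> [Dt|->//]; apply/le_anti; rewrite Dt andbT.
  by case/andP : tD.
- by apply: curve_policy_level_le => //; exact: ltW.
- by move=> ?; apply: curve_policy_level_eq => //; exact: ltW.
Qed.
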